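(* Let $U \subset \mathbb{R}^d$ be bounded, connected and open, with $U = U^h$ for some $h>0$. Let $(x_n)_{n\ge1}$ be a sequence of points of $U$ such that $\{x_n : n \ge 1\}$ is dense in $U$, and set $\Omega_n = \{x_1,\dots,x_n\}$ and $\varepsilon_n = \delta_H(\Omega_n,U)$. Let $\phi_n : \Omega_n \to Q$ be functions with values in a bounded set $Q \subset \mathbb{R}^d$, and let $r_n > 0$ be given. Assume that $\phi_n$ is isotonic over balls of radius $r_n$, that is, $\phi_n$ is isotonic on $\Omega_n \cap B(x,r_n)$ for any $x \in \Omega_n$, and that for all $x,x',x^\dagger,x^\ddagger \in \Omega_n$, $\|x-x'\| < r_n \le \|x^\dagger - x^\ddagger\|$ implies $\|\phi_n(x)-\phi_n(x')\| \le \|\phi_n(x^\dagger)-\phi_n(x^\ddagger)\|$. Then there is a constant $C>0$ depending only on $(d,h,\rho(U),\operatorname{diam}(U),\operatorname{diam}(Q))$ and similarities $S_n$ such that $$\max_{x\in\Omega_n}\|\phi_n(x)-S_n(x)\| \le C\, \varepsilon_n/r_n^2 .$$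
   Context: $\|\cdot\|$ is the Euclidean norm, $B(x,r)$ the open ball with center $x$ and radius $r$, $\operatorname{diam}(V) = \sup_{x,y\in V}\|x-y\|$. For $\Lambda\subset V\subset\mathbb{R}^d$, $\delta_H(\Lambda,V) = \sup_{y \in V}\inf_{x \in \Lambda}\|y-x\|$. $\rho(V) = \sup\{r>0 : \exists v \in V,\ B(v,r/2)\subset V\}$ is the diameter of a largest ball inscribed in $V$. For $h>0$, $V^h = \{x \in V : \exists y \in V \text{ with } x \in B(y,h) \subset V\}$. A function $f$ is isotonic on a set $A\subset\mathbb{R}^d$ if for all $x,y,x',y' \in A$: $\|x-y\| < \|x'-y'\|$ implies $\|f(x)-f(y)\| \le \|f(x')-f(y')\|$. A similarity is a map $f : \mathbb{R}^d \to \mathbb{R}^d$ such that, for some $\lambda>0$, $\|f(x)-f(y)\| = \lambda\|x-y\|$ for all $x,y$; equivalently, $f(x) = \lambda R(x) + b$ with $R$ orthogonal and $b \in \mathbb{R}^d$ constant.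
   Formalization: The radii are additionally assumed to satisfy r_n ≤ diam(U); for r_n > diam(U) the hypotheses no longer depend on r_n while the bound Cε_n/r_n² tends to 0 as r_n grows, so the claim as stated fails. *)

(* Defs.v *)
From mathcomp Require Import all_boot all_order all_algebra.
From mathcomp Require Import all_classical all_reals all_analysis.

Set Implicit Arguments.
Unset Strict Implicit.
Unset Printing Implicit Defensive.

Import Order.TTheory GRing.Theory Num.Theory.
Import numFieldNormedType.Exports.

Local Open Scope classical_set_scope.
Local Open Scope ring_scope.

Section Euclidean.
Context {R : realType} {d : nat}.
Implicit Types (x y v : 'rV[R]_d) (A V L : set 'rV[R]_d) (f : 'rV[R]_d -> 'rV[R]_d).

(* The library norm `|x| on 'rV[R]_d is the sup norm, so the Euclidean norm is
   defined here. Both norms induce the same topology and the same bounded sets,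
   so open, connected, closure and bounded_set are the library's. *)
Definition enorm x : R := Num.sqrt (\sum_(i < d) x ord0 i ^+ 2).

Definition eball x (r : R) : set 'rV[R]_d := [set y | enorm (y - x) < r].

Definition diam V : R := sup [set enorm (x - y) | x in V & y in V].

(* One-sided: L is meant to be a subset of V. *)
Definition delta_H L V : R :=
  sup [set inf [set enorm (y - x) | x in L] | y in V].

Definition rho V : R :=
  sup [set r | 0 < r /\ exists2 v, V v & eball v (r / 2) `<=` V].

Definition thick V (h : R) : set 'rV[R]_d :=
  [set x | V x /\ exists y, [/\ V y, eball y h x & eball y h `<=` V]].

Definition isotonic f A : Prop :=
  forall x y x' y', A x -> A y -> A x' -> A y' ->
    enorm (x - y) < enorm (x' - y') ->
    enorm (f x - f y) <= enorm (f x' - f y').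

Definition similarity f : Prop :=
  exists2 lambda : R, 0 < lambda &
    forall x y, enorm (f x - f y) = lambda * enorm (x - y).

(* Sequences are indexed from 1: the value x 0 is never used. *)
Definition Omega (x : nat -> 'rV[R]_d) (n : nat) : set 'rV[R]_d :=
  [set x i | i in [set i | (1 <= i <= n)%N]].

End Euclidean.

(* Main.v *)
Require Import Defs.
From mathcomp Require Import all_boot all_order all_algebra.
From mathcomp Require Import all_classical all_reals all_analysis.
From mathcomp Require Import ring lra.
Import Order.TTheory GRing.Theory Num.Theory.
Import numFieldNormedType.Exports.
Local Open Scope classical_set_scope.
Local Open Scope ring_scope.

Set Implicit Arguments.
Unset Strict Implicit.
Unset Printing Implicit Defensive.

(** Isotonicity makes the distance between images of points of [Omega] an approximate function
    [g] of their distance, on a ball where [Omega] is [eps]-dense; a packing count of separated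
    points shows that [g] varies by [O(eps)] over distances of size [eps]. Equidistance from
    the vertices of a cross-polytope forces the images of collinear points to be nearly
    collinear, so that [g] is approximately additive, hence approximately linear
    (Hyers-Ulam), and trilateration from the cross-polytope makes the map [O(eps)]-close to a
    similarity. Since only distances matter, this also holds slightly beyond the ball where
    [Omega] is dense, which links neighbouring balls even when they meet in a thin part of
    [U]. With balls of radius [s] comparable to [r], any two are joined by a chain of [O(1/s)]
    neighbours, and the local errors [O(eps)] (the scale of the images being [O(s)]) are
    amplified by [O(1/s)] at each step when compared on all of [U]: the total is
    [O(eps / s^2)]. *)

(** The scale of the local images is not known in advance: a priori a ball of radius [s] could have
    an image of diameter comparable to that of [Q], and local errors [O(eps / s)] would accumulate
    to [O(eps / s^3)]. Local errors are therefore measured relative to the diameter of the local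
    image, and the reference is a ball whose image is nearly the largest. The ratio [l] of the
    similarity found there controls every local error, so the accumulated error is
    [O(l * eps / s^2)]. Once [eps / s^2] is below a constant, this is at most [l * h / 8]; two
    points of [U] about [h] apart, whose images are at bounded distance, then give an absolute bound
    on [l]. When [eps / s^2] is not small, boundedness of the images makes the claim trivial.
    Uniformity in [U] comes from pigeonhole on cubic grids, which counts both the separated points
    and the links of the chains. *)

Section EuclideanNorm.
Context {R : realType} {d : nat}.
Implicit Types (x y z : 'rV[R]_d) (a : R).

Definition dot x y : R := \sum_i x ord0 i * y ord0 i.

Lemma dotC x y : dot x y = dot y x.
Proof. by apply: eq_bigr => i _; rewrite mulrC. Qed.

Lemma dotDl x y z : dot (x + y) z = dot x z + dot y z.
Proof. by rewrite -big_split; apply: eq_bigr => i _; rewrite mxE mulrDl. Qed.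

Lemma dotZl a x y : dot (a *: x) y = a * dot x y.
Proof. by rewrite mulr_sumr; apply: eq_bigr => i _; rewrite mxE mulrA. Qed.

Lemma dotNl x y : dot (- x) y = - dot x y.
Proof. by rewrite -scaleN1r dotZl mulN1r. Qed.

Lemma dotDr x y z : dot x (y + z) = dot x y + dot x z.
Proof. by rewrite dotC dotDl !(dotC x). Qed.

Lemma dotZr a x y : dot x (a *: y) = a * dot x y.
Proof. by rewrite dotC dotZl dotC. Qed.

Lemma dotNr x y : dot x (- y) = - dot x y.
Proof. by rewrite dotC dotNl dotC. Qed.

Definition dotE := (dotDl, dotDr, dotZl, dotZr, dotNl, dotNr).

Lemma dot0l x : dot 0 x = 0.
Proof. by rewrite -(scale0r 0) dotZl mul0r. Qed.

Lemma dot_suml n (f : nat -> 'rV[R]_d) x :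
  dot (\sum_(i < n) f i) x = \sum_(i < n) dot (f i) x.
Proof.
elim: n => [|n IH]; first by rewrite !big_ord0 dot0l.
by rewrite !big_ord_recr /= dotDl IH.
Qed.

Lemma dot_ge0 x : 0 <= dot x x.
Proof. by apply: sumr_ge0 => i _; rewrite -expr2 sqr_ge0. Qed.

Lemma enormE x : enorm x = Num.sqrt (dot x x).
Proof. by congr Num.sqrt; apply: eq_bigr => i _; rewrite expr2. Qed.

Lemma enorm_sqr x : enorm x ^+ 2 = dot x x.
Proof. by rewrite enormE sqr_sqrtr // dot_ge0. Qed.

Lemma enorm_ge0 x : 0 <= enorm x.
Proof. exact: sqrtr_ge0. Qed.

Lemma enorm0 : enorm (0 : 'rV[R]_d) = 0.
Proof. by rewrite enormE dot0l sqrtr0. Qed.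

Lemma enorm0_eq0 x : enorm x = 0 -> x = 0.
Proof.
move=> x0; have /eqP := enorm_sqr x; rewrite x0 expr0n /= eq_sym psumr_eq0 => [|i _];
  last by rewrite -expr2 sqr_ge0.
move=> /allP h; apply/rowP => i; rewrite mxE; apply/eqP.
by have := h i (mem_index_enum i); rewrite /= mulf_eq0 orbb.
Qed.

Lemma enormZ a x : enorm (a *: x) = `|a| * enorm x.
Proof.
by rewrite !enormE dotZl dotZr mulrA -expr2 sqrtrM ?sqr_ge0// sqrtr_sqr.
Qed.

Lemma enormN x : enorm (- x) = enorm x.
Proof. by rewrite -scaleN1r enormZ normrN1 mul1r. Qed.

Lemma enorm_distC x y : enorm (x - y) = enorm (y - x).
Proof. by rewrite -opprB enormN. Qed.

Lemma dot_le_enorm x y : dot x y <= enorm x * enorm y.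
Proof.
have [/enorm0_eq0 ->|x0] := eqVneq (enorm x) 0; first by rewrite dot0l enorm0 mul0r.
have [/enorm0_eq0 ->|y0] := eqVneq (enorm y) 0.
  by rewrite dotC dot0l enorm0 mulr0.
have xp : 0 < enorm x by rewrite lt0r x0 enorm_ge0.
have yp : 0 < enorm y by rewrite lt0r y0 enorm_ge0.
have := dot_ge0 (enorm y *: x - enorm x *: y).
rewrite !dotE -!enorm_sqr (dotC y x) => h.
rewrite -subr_ge0 -(pmulr_rge0 _ (mulr_gt0 xp yp)).
by move: h; set q := dot x y; nra.
Qed.

Lemma normr_dot_le x y : `|dot x y| <= enorm x * enorm y.
Proof.
by rewrite ler_norml dot_le_enorm andbT lerNl -dotNl -(enormN x) dot_le_enorm.
Qed.

Lemma enormD x y : enorm (x + y) <= enorm x + enorm y.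
Proof.
rewrite -(@ler_pXn2r _ 2) ?nnegrE ?addr_ge0 ?enorm_ge0// enorm_sqr !dotE -!enorm_sqr.
by have := dot_le_enorm x y; rewrite (dotC y x); nra.
Qed.

Lemma enormB_le x y : enorm (x - y) <= enorm x + enorm y.
Proof. by rewrite -(enormN y) enormD. Qed.

Lemma enorm_triangle z x y : enorm (x - y) <= enorm (x - z) + enorm (z - y).
Proof. by rewrite -{1}(subrK z x) -addrA enormD. Qed.

Lemma enorm_sum_le n (f : nat -> 'rV[R]_d) :
  enorm (\sum_(i < n) f i) <= \sum_(i < n) enorm (f i).
Proof.
elim: n => [|n IH]; first by rewrite !big_ord0 enorm0.
by rewrite !big_ord_recr /=; apply: le_trans (enormD _ _) _; rewrite lerD2r.
Qed.

Lemma coord_le_enorm x i : `|x ord0 i| <= enorm x.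
Proof.
rewrite -(@ler_pXn2r _ 2) ?nnegrE ?enorm_ge0// enorm_sqr /dot (bigD1 i)//=.
by rewrite real_normK ?num_real// expr2 lerDl sumr_ge0// => j _; rewrite -expr2 sqr_ge0.
Qed.

Lemma enorm_le_sum_coord x : enorm x <= \sum_i `|x ord0 i|.
Proof.
rewrite -(@ler_pXn2r _ 2) ?nnegrE ?enorm_ge0 ?sumr_ge0// enorm_sqr.
rewrite expr2 mulr_suml; apply: ler_sum => i _.
rewrite (bigD1 i)//= mulrDr -normrM (le_trans (ler_norm _))//.
by rewrite lerDl mulr_ge0// sumr_ge0.
Qed.

Lemma enorm_le_coord x a : (forall i, `|x ord0 i| <= a) -> enorm x <= d%:R * a.
Proof.
move=> h; apply: le_trans (enorm_le_sum_coord _) _.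
apply: (@le_trans _ _ (\sum_(i < d) a)); first by apply: ler_sum.
by rewrite sumr_const card_ord mulr_natl.
Qed.

(* The polarisation that turns approximate distances into approximate inner products. *)
Lemma dot_polar4 (p q a b : 'rV[R]_d) :
  2 * dot (p - q) (a - b) = enorm (p - b) ^+ 2 - enorm (p - a) ^+ 2
    - enorm (q - b) ^+ 2 + enorm (q - a) ^+ 2.
Proof.
rewrite !enorm_sqr !dotE (dotC b p) (dotC a p) (dotC b q) (dotC a q); ring.
Qed.

Lemma orthonormal_enorm (O : 'M[R]_d) x : O *m O^T = 1%:M -> enorm (x *m O) = enorm x.
Proof.
move=> OO; have tr y : dot y y = (y *m y^T) ord0 ord0.
  by rewrite mxE; apply: eq_bigr => i _; rewrite mxE.
by rewrite !enormE !tr trmx_mul mulmxA -(mulmxA x) OO mulmx1.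
Qed.

End EuclideanNorm.

(** * Stability of Gram-Schmidt orthonormalisation *)

Lemma sqr_dist_le1 (R : realType) (a eta : R) : 0 <= a -> `|a ^+ 2 - 1| <= eta -> `|a - 1| <= eta.
Proof. by move=> a0 h; apply/ler_normlP; move/ler_normlP: h => [h1 h2]; split; nra. Qed.

Lemma gram_schmidt_stability (R : realType) (d n : nat) :
  exists C e0 : R, [/\ 0 < C, 0 < e0 & forall (u : nat -> 'rV[R]_d) (eta : R),
    0 <= eta <= e0 ->
    (forall i j, (i < n)%N -> (j < n)%N -> `|dot (u i) (u j) - (i == j)%:R| <= eta) ->
    exists o : nat -> 'rV[R]_d,
      (forall i j, (i < n)%N -> (j < n)%N -> dot (o i) (o j) = (i == j)%:R) /\
      forall i, (i < n)%N -> enorm (u i - o i) <= C * eta].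
Proof.
elim: n => [|n [C [e0 [C0 e00 IH]]]].
  by exists 1, 1; split => // u eta _ _; exists u; split.
pose K := n%:R * (1 + 2 * C).
have K0 : 0 <= K by rewrite mulr_ge0//; lra.
(* The projection of the last vector on the previous ones has norm at most [K * eta], and
   normalising the remainder costs [(K + 1) * eta]. The threshold gives [(K + 1) * eta <= 1/2],
   which keeps the remainder nonzero. *)
exists (C + 2 * K + 1), (Num.min e0 (Num.min 1 (2 * (K + 1))^-1)); split; first lra.
  by rewrite !lt_min e00 ltr01 invr_gt0; lra.
move=> u eta; rewrite !le_min => /and4P[eta0 etae0 eta1 etaK] hu.
have {}etaK : eta * (K + 1) <= 1 / 2.
  have := ler_wpM2r (_ : 0 <= K + 1) etaK; rewrite invfM -mulrA mulVf; lra.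
have [||o [oo uo]] := IH u eta.
- by rewrite eta0.
- by move=> i j hi hj; apply: hu; exact: leqW.
have un1 : `|enorm (u n) - 1| <= eta.
  by apply: sqr_dist_le1; rewrite ?enorm_ge0// enorm_sqr; have := hu n n (ltnSn n) (ltnSn n); rewrite eqxx.
have un2 : enorm (u n) <= 2 by move/ler_normlP : un1 => [_]; lra.
pose c j := dot (u n) (o j).
have cj j : (j < n)%N -> `|c j| <= (1 + 2 * C) * eta.
  move=> jn; rewrite /c -(subKr (u j) (o j)) dotDr dotNr.
  have h1 := hu n j (ltnSn n) (leqW jn); rewrite gtn_eqF// subr0 in h1.
  have h2 := normr_dot_le (u n) (u j - o j).
  have h3 : enorm (u n) * enorm (u j - o j) <= 2 * (C * eta).
    by apply: ler_pM => //; rewrite ?enorm_ge0 ?uo.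
  have := ler_normB (dot (u n) (u j)) (dot (u n) (u j - o j)); lra.
pose v := \sum_(j < n) c j *: o j; pose w := u n - v.
have nv : enorm v <= K * eta.
  apply: le_trans (enorm_sum_le n (fun j => c j *: o j)) _.
  apply: (@le_trans _ _ (\sum_(j < n) ((1 + 2 * C) * eta))); last first.
    by rewrite sumr_const card_ord /K -[leRHS]mulrA (mulr_natl _ n).
  apply: ler_sum => j _; rewrite enormZ enormE oo// eqxx sqrtr1 mulr1; exact: cj.
have wo j : (j < n)%N -> dot w (o j) = 0.
  move=> jn; rewrite dotDl dotNl (dot_suml n (fun j => c j *: o j)).
  rewrite (bigD1 (Ordinal jn))//= dotZl oo// eqxx mulr1 big1 ?addr0 ?subrr//.
  move=> i; rewrite -val_eqE /= => /negPf ij; by rewrite dotZl oo// ij mulr0.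
have w1 : `|enorm w - 1| <= (K + 1) * eta.
  have h1 := enormD w v; have h2 := enormB_le (u n) v.
  rewrite subrK in h1; move: h2; rewrite -/w => h2.
  move/ler_normlP : un1 => [h3 h4]; apply/ler_normlP; split; lra.
have w0 : 0 < enorm w by move/ler_normlP : w1 => [h3 h4]; lra.
exists (fun j => if (j < n)%N then o j else (enorm w)^-1 *: w); split=> [i j|i]; last first.
  rewrite ltnS leq_eqVlt => /predU1P[->|jn].
    rewrite ltnn.
    have -> : u n - (enorm w)^-1 *: w = v + (1 - (enorm w)^-1) *: w.
      by rewrite scalerBl scale1r addrA /w (addrC v) subrK.
    apply: le_trans (enormD _ _) _; rewrite enormZ.
    have -> : `|1 - (enorm w)^-1| * enorm w = `|enorm w - 1|.
      by rewrite -{2}(gtr0_norm w0) -normrM mulrBl mul1r mulVf// gt_eqF.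
    have : 0 <= C * eta by rewrite mulr_ge0// ltW.
    lra.
  rewrite jn; apply: le_trans (uo _ jn) _; rewrite ler_wpM2r//; lra.
rewrite !ltnS [(i <= n)%N]leq_eqVlt [(j <= n)%N]leq_eqVlt.
move=> /predU1P[->|iN] /predU1P[->|jn]; rewrite ?ltnn ?iN ?jn.
- by rewrite eqxx dotZl dotZr -enorm_sqr /=; field; rewrite gt_eqF.
- by rewrite dotZl wo// mulr0 gtn_eqF.
- by rewrite dotZr dotC wo// mulr0 ltn_eqF.
- by rewrite oo.
Qed.

(** * Coordinate axes and orthonormal bases *)

Definition axis {R : realType} {d : nat} (i : 'I_d) (t : R) : 'rV[R]_d := t *: delta_mx ord0 i.

Section Axis.
Context {R : realType} {d : nat}.
Implicit Types (i j : 'I_d) (s t : R) (x : 'rV[R]_d).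

Lemma dot_delta x i : dot x (delta_mx ord0 i) = x ord0 i.
Proof.
rewrite /dot (bigD1 i)//= mxE !eqxx mulr1 big1 ?addr0// => j /negPf ji.
by rewrite mxE ji andbF mulr0.
Qed.

Lemma dot_axis i j t s : dot (axis i t) (axis j s) = t * s * (i == j)%:R.
Proof. by rewrite dotZl dotZr dot_delta mxE eqxx /= [j == i]eq_sym mulrA. Qed.

Lemma dot_axisr x i t : dot x (axis i t) = t * x ord0 i.
Proof. by rewrite dotZr dot_delta. Qed.

Lemma enorm_axis i t : enorm (axis i t) = `|t|.
Proof. by rewrite enormE dot_axis eqxx mulr1 -expr2 sqrtr_sqr. Qed.

Lemma axisB i t s : axis i t - axis i s = axis i (t - s).
Proof. by rewrite /axis scalerBl. Qed.

Lemma enorm_axisB i t s : enorm (axis i t - axis i s) = `|t - s|.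
Proof. by rewrite axisB enorm_axis. Qed.

Lemma enorm_axis_equidistant i j t s : i != j ->
  enorm (axis i t - axis j (- s)) = enorm (axis i t - axis j s).
Proof.
move=> /negPf ij; rewrite !enormE; congr Num.sqrt.
by rewrite !(dotDl, dotDr, dotNl, dotNr) !dot_axis ij eq_sym ij !eqxx /=; ring.
Qed.

End Axis.

Section OrthonormalFamily.
Context {R : realType} {d : nat}.
Implicit Types (o : 'I_d -> 'rV[R]_d) (x : 'rV[R]_d).

Definition orthonormal o := forall i j, dot (o i) (o j) = (i == j)%:R.

Definition family_mx o : 'M[R]_d := \matrix_(i, j) o i ord0 j.

Lemma family_mx_orthonormal o : orthonormal o -> family_mx o *m (family_mx o)^T = 1%:M.
Proof.
move=> oo; apply/matrixP => i j; rewrite !mxE -(oo i j).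
by apply: eq_bigr => k _; rewrite !mxE.
Qed.

(** A square matrix with orthonormal rows has orthonormal columns ([mulmx1C]), so [x] has the norm
    of its vector of coordinates in the family. *)
Lemma enorm_le_sum_dot o x : orthonormal o -> enorm x <= \sum_i `|dot x (o i)|.
Proof.
move=> /family_mx_orthonormal /mulmx1C h.
have <- : enorm (x *m (family_mx o)^T) = enorm x by apply: orthonormal_enorm; rewrite trmxK.
apply: le_trans (enorm_le_sum_coord _) _; apply: ler_sum => i _.
rewrite [X in `|X|](_ : _ = dot x (o i))// mxE.
by apply: eq_bigr => k _; rewrite !mxE.
Qed.

Lemma dot_mul_family_mx o x i : orthonormal o -> dot (x *m family_mx o) (o i) = x ord0 i.
Proof.
move=> /family_mx_orthonormal h.
have -> : dot (x *m family_mx o) (o i) = (x *m family_mx o *m (family_mx o)^T) ord0 i.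
  by rewrite [RHS]mxE; apply: eq_bigr => k _; rewrite !mxE.
by rewrite -mulmxA h mulmx1.
Qed.

Lemma enorm_orthonormal o i : orthonormal o -> enorm (o i) = 1.
Proof. by move=> oo; rewrite enormE oo eqxx sqrtr1. Qed.

End OrthonormalFamily.

Lemma gram_schmidt_family (R : realType) (d : nat) :
  exists C e0 : R, [/\ 0 < C, 0 < e0 & forall (u : 'I_d -> 'rV[R]_d) (eta : R),
    0 <= eta <= e0 ->
    (forall i j, `|dot (u i) (u j) - (i == j)%:R| <= eta) ->
    exists2 o, orthonormal o & forall i, enorm (u i - o i) <= C * eta].
Proof.
have [C [e0 [C0 e00 H]]] := gram_schmidt_stability R d d.
exists C, e0; split=> // u eta he hu.
pose u' n := if insub n is Some i then u i else 0.
have u'E (i : 'I_d) : u' i = u i by rewrite /u' valK.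
have [|o [oo uo]] := H u' eta he.
  by move=> i j hi hj; have := hu (Ordinal hi) (Ordinal hj); rewrite -!u'E.
exists (fun i : 'I_d => o i) => [i j|i]; first by rewrite oo.
by rewrite -u'E uo.
Qed.

(* [F] maps pairs at distance [t] to pairs at distance [g t], up to the error [e];
   the numerical bounds fix the scale of the images. *)
Record gauged {R : realType} {d : nat} (D : set 'rV[R]_d) (F : 'rV[R]_d -> 'rV[R]_d)
    (g : R -> R) (e : R) : Prop := Gauged {
  gauged_e : 0 <= e <= 1;
  gauged_ball : eball 0 1 `<=` D;
  gauged_mono : forall s t, 0 <= s <= t -> t <= 3/2 -> g s <= g t;
  gauged_bound : forall t, 0 <= t <= 3/2 -> 0 <= g t <= 2;
  gauged_half : 1/10 <= g (1/2);
  gauged_dist : forall y z, D y -> D z -> enorm (y - z) <= 3/2 ->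
    `|enorm (F y - F z) - g (enorm (y - z))| <= e }.

Lemma sqr_close (R : realType) (x y a e : R) : 0 <= e <= 1 -> 0 <= a <= 2 -> 0 <= x -> 0 <= y ->
  `|x - a| <= e -> `|y - a| <= e -> `|x ^+ 2 - y ^+ 2| <= 12 * e.
Proof.
move=> /andP[e0 e1] /andP[a0 a2] x0 y0 /ler_normlP[h1 h2] /ler_normlP[h3 h4].
rewrite subr_sqr normrM.
have h : `|x - y| <= 2 * e by apply/ler_normlP; split; lra.
have k : `|x + y| <= 6 by apply/ler_normlP; split; lra.
by have := ler_pM (normr_ge0 _) (normr_ge0 _) h k; lra.
Qed.

(** * Inner products of images under a gauged map *)

Section Gauged.
Context {R : realType} {d : nat} {D : set 'rV[R]_d} {F : 'rV[R]_d -> 'rV[R]_d}.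
Context {g : R -> R} {e : R} (H : gauged D F g e).

Lemma gauged_axis (i : 'I_d) t : -1 < t < 1 -> D (axis i t).
Proof.
move=> t1; have h : eball 0 1 (axis i t) by rewrite /eball /= subr0 enorm_axis ltr_norml.
exact: (gauged_ball H h).
Qed.

Lemma gauged_sqr y z a b : D y -> D z -> D a -> D b ->
  enorm (y - z) <= 3/2 -> enorm (a - b) = enorm (y - z) ->
  `|enorm (F y - F z) ^+ 2 - enorm (F a - F b) ^+ 2| <= 12 * e.
Proof.
move=> Dy Dz Da Db h1 h2; apply: (@sqr_close _ _ _ (g (enorm (y - z)))).
- exact: gauged_e H.
- by apply: (gauged_bound H); rewrite enorm_ge0.
- exact: enorm_ge0.
- exact: enorm_ge0.
- exact: (gauged_dist H).
- by rewrite -h2; apply: (gauged_dist H) => //; rewrite h2.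
Qed.

Lemma gauged_sqr_gauge y z : D y -> D z -> enorm (y - z) <= 3/2 ->
  `|enorm (F y - F z) ^+ 2 - g (enorm (y - z)) ^+ 2| <= 12 * e.
Proof.
move=> Dy Dz h1; have gb : 0 <= g (enorm (y - z)) <= 2.
  by apply: (gauged_bound H); rewrite enorm_ge0.
apply: (@sqr_close _ _ _ (g (enorm (y - z)))) => //.
- exact: gauged_e H.
- exact: enorm_ge0.
- by case/andP: gb.
- exact: (gauged_dist H).
- by rewrite subrr normr0; case/andP: (gauged_e H).
Qed.

Lemma gauged_le3 y z : D y -> D z -> enorm (y - z) <= 3/2 -> enorm (F y - F z) <= 3.
Proof.
move=> Dy Dz h; have := gauged_dist H Dy Dz h; have /andP[_ e1] := gauged_e H.
have /andP[_ g2] : 0 <= g (enorm (y - z)) <= 2.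
  by apply: (gauged_bound H); rewrite enorm_ge0.
by move=> /ler_normlP[_]; lra.
Qed.

(** In [dot_polar4] the four squared distances cancel in pairs, each pair up to [12 * e]: the images
    inherit the orthogonality of [p - q] and [a - b]. *)
Lemma gauged_dot_equidistant p q a b : D p -> D q -> D a -> D b ->
  enorm (p - a) <= 3/2 -> enorm (p - b) = enorm (p - a) ->
  enorm (q - a) <= 3/2 -> enorm (q - b) = enorm (q - a) ->
  `|dot (F p - F q) (F a - F b)| <= 12 * e.
Proof.
move=> Dp Dq Da Db pa pb qa qb; have := dot_polar4 (F p) (F q) (F a) (F b).
have := gauged_sqr Dp Da Dp Db pa pb; have := gauged_sqr Dq Da Dq Db qa qb.
move=> /ler_normlP[h1 h2] /ler_normlP[h3 h4] h5; apply/ler_normlP; split; lra.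
Qed.

(** Image of the [i]-th diagonal of the cross-polytope with vertices at distance [1/4] from the
    origin. The diagonal has length [1/2], so [g (1/2)] normalises its image. *)
Definition frame_vector (i : 'I_d) := F (axis i (1/4)) - F (axis i (- (1/4))).

Lemma axis_quarter_dist (i : 'I_d) :
  enorm (axis i (1/4) - axis i (- (1/4)) : 'rV[R]_d) = 1/2.
Proof. by rewrite enorm_axisB ger0_norm; lra. Qed.

(** Each vertex on one axis is equidistant from the two vertices on another, which handles [i != j];
    for [i = j] the gauge is read at [1/2]. The constant is [12] times the bound [100] on
    [g (1/2) ^- 2]. *)
Lemma frame_dot i j :
  `|dot ((g (1/2))^-1 *: frame_vector i) ((g (1/2))^-1 *: frame_vector j) - (i == j)%:R|
    <= 1200 * e.
Proof.
set G := g (1/2); have G1 : 1/10 <= G by exact: gauged_half H.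
have GG : G^-1 * G^-1 <= 100.
  have h : G^-1 <= 10 by rewrite -[leRHS]invrK lef_pV2 ?posrE//; lra.
  have h0 : 0 <= G^-1 by rewrite invr_ge0; lra.
  by apply: le_trans (ler_pM h0 h0 h h) _; lra.
have e0 : 0 <= e by case/andP: (gauged_e H).
have GG0 : 0 <= G^-1 * G^-1 by rewrite mulr_ge0// invr_ge0; lra.
have D1 k : D (axis k (1/4)) by apply: gauged_axis; lra.
have D2 k : D (axis k (- (1/4))) by apply: gauged_axis; lra.
rewrite dotZl dotZr mulrA.
suff [x -> hx] : exists2 x, G^-1 * G^-1 * dot (frame_vector i) (frame_vector j) - (i == j)%:R
    = G^-1 * G^-1 * x & `|x| <= 12 * e.
  rewrite normrM ger0_norm//; apply: le_trans (ler_pM GG0 (normr_ge0 _) GG hx) _; lra.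
have [<-|ij] := eqVneq i j.
  exists (enorm (frame_vector i) ^+ 2 - G ^+ 2).
    by rewrite -enorm_sqr /=; field; rewrite gt_eqF//; lra.
  have := @gauged_sqr_gauge (axis i (1/4)) (axis i (- (1/4))) (D1 _) (D2 _).
  by rewrite axis_quarter_dist; apply; lra.
exists (dot (frame_vector i) (frame_vector j)); first by rewrite subr0.
have k (t : R) : `|t| = 1/4 -> enorm (axis i t - axis j (1/4)) <= 3/2.
  by move=> ht; apply: le_trans (enormB_le _ _) _; rewrite !enorm_axis ht ger0_norm; lra.
apply: gauged_dot_equidistant => //; rewrite ?enorm_axis_equidistant// k// ?normrN ger0_norm; lra.
Qed.

End Gauged.

Lemma gauged_frame (R : realType) (d : nat) : exists C e0 : R, [/\ 0 < C, 0 < e0 &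
  forall D F g e, @gauged R d D F g e -> e <= e0 ->
    exists2 o, orthonormal o & forall i,
      enorm ((g (1/2))^-1 *: frame_vector (F := F) i - o i) <= C * e].
Proof.
have [C [e0 [C0 e00 HGS]]] := gram_schmidt_family R d.
exists (1200 * C), (e0 / 1200); split; [lra|lra|] => D F g e H he.
have /andP[h0 h1] := gauged_e H.
have [|o oo uo] := HGS _ (1200 * e) _ (frame_dot H); first by lra.
by exists o => // i; apply: le_trans (uo i) _; lra.
Qed.

(** Applied to the difference of the images of two points of the [k]-th axis, this reduces their
    distance to a signed number on a line. *)
Lemma enorm_near_dot (R : realType) (d : nat) (o : 'I_d -> 'rV[R]_d) (x : 'rV[R]_d) (k : 'I_d)
    (b : R) : orthonormal o -> 0 <= b -> (forall i, i != k -> `|dot x (o i)| <= b) ->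
  `|dot x (o k)| <= enorm x <= `|dot x (o k)| + d%:R * b.
Proof.
move=> oo b0 h; have := normr_dot_le x (o k); rewrite enorm_orthonormal// mulr1 => -> /=.
apply: le_trans (enorm_le_sum_dot _ oo) _; rewrite (bigD1 k)//= lerD2l.
apply: (@le_trans _ _ (\sum_(i < d) b)); last by rewrite sumr_const card_ord mulr_natl.
by rewrite big_mkcond; apply: ler_sum => i _; case: ifP => // /h.
Qed.

Lemma dot_frame_close (R : realType) (d : nat) (x v o : 'rV[R]_d) (G r b c : R) :
  1/10 <= G -> enorm x <= 3 -> enorm (G^-1 *: v - o) <= c -> `|dot x v - r| <= b ->
  `|dot x o - G^-1 * r| <= 10 * b + 3 * c.
Proof.
move=> G1 x3 vo h.
have G10 : G^-1 <= 10 by rewrite -[leRHS]invrK lef_pV2 ?posrE//; lra.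
have G0 : 0 <= G^-1 by rewrite invr_ge0; lra.
have -> : dot x o - G^-1 * r = G^-1 * (dot x v - r) - dot x (G^-1 *: v - o).
  by rewrite dotDr dotNr dotZr; ring.
apply: le_trans (ler_normB _ _) _; apply: lerD.
  by rewrite normrM ger0_norm//; exact: ler_pM.
apply: le_trans (normr_dot_le _ _) _; exact: ler_pM (enorm_ge0 _) (enorm_ge0 _) _ _.
Qed.

(** * Additivity and linearity of the gauge *)

Lemma approx_additive_abs (R : realType) (x y gs gt gst E : R) : 0 <= gs <= gst -> 0 <= gt <= gst ->
  `|gs - `|x| | <= E -> `|gt - `|y| | <= E -> `|gst - `|x + y| | <= E ->
  `|gst - gs - gt| <= 3 * E.
Proof.
wlog x0 : x y / 0 <= x.
  move=> h; have [x0|x0] := leP 0 x; first exact: h.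
  move=> h1 h2; rewrite -(normrN x) -(normrN y) -(normrN (x + y)) opprD.
  by apply: h => //; lra.
move=> /andP[h1 h2] /andP[h3 h4]; rewrite (ger0_norm x0).
move=> /ler_normlP[h5 h6]; have [y0|y0] := ger0P y.
  rewrite (ger0_norm (addr_ge0 x0 y0)) => /ler_normlP[h7 h8] /ler_normlP[h9 h10].
  by apply/ler_normlP; split; lra.
(* With opposite signs the absolute values subtract instead of adding. Since [gst] dominates [gs]
   and [gt], the smaller of the two absolute values is then at most [2 * E], and additivity
   survives. *)
move=> /ler_normlP[h7 h8] /ler_normlP[]; have [xy|xy] := ger0P (x + y) => h9 h10;
  apply/ler_normlP; split; lra.
Qed.

(** Points of the [k]-th axis are equidistant from the two vertices on every other axis, so
    differences of their images are nearly parallel to [o k]. Three points of the segment from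
    [-3/4] to [3/4], at mutual distances [s], [t] and [s + t], give the additivity; the length of
    this segment is the range [3/2] of the gauge. *)
Lemma gauge_superadditive (R : realType) (d : nat) (k : 'I_d) : exists C e0 : R,
  [/\ 0 < C, 0 < e0 & forall D F g e, @gauged R d D F g e -> e <= e0 ->
    forall s t, 0 <= s -> 0 <= t -> s + t <= 3/2 -> `|g (s + t) - g s - g t| <= C * e].
Proof.
have [C [e0 [C0 e00 HF]]] := gauged_frame R d.
pose K := 10 * 12 + 3 * C; have K0 : 0 < K by rewrite /K; lra.
have dK : 0 <= d%:R * K by rewrite mulr_ge0// ltW.
exists (3 * (d%:R * K + 1)), e0; split; [lra|by []|] => D F g e H he.
have [ o oo uo] := HF _ _ _ _ H he; have /andP[e_ge0 _] := gauged_e H.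
have line u v : - (3/4) <= u <= 3/4 -> - (3/4) <= v <= 3/4 ->
    `|g `|u - v| - `|dot (F (axis k u) - F (axis k v)) (o k)| | <= (d%:R * K + 1) * e.
  move=> hu hv.
  have Du : D (axis k u) by apply: (gauged_axis H); lra.
  have Dv : D (axis k v) by apply: (gauged_axis H); lra.
  have uv : enorm (axis k u - axis k v) <= 3/2.
    by rewrite enorm_axisB; apply/ler_normlP; split; lra.
  have := gauged_dist H Du Dv uv; rewrite enorm_axisB => /ler_normlP[h1 h2].
  have /andP[h3 h4] : `|dot (F (axis k u) - F (axis k v)) (o k)|
      <= enorm (F (axis k u) - F (axis k v))
      <= `|dot (F (axis k u) - F (axis k v)) (o k)| + d%:R * (K * e).
    apply: enorm_near_dot => // [|i ik]; first by rewrite mulr_ge0// ltW.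
    have ki : k != i by rewrite eq_sym.
    have q w : - (3/4) <= w <= 3/4 -> enorm (axis k w - axis i (1/4) : 'rV[R]_d) <= 3/2.
      move=> /andP[w1 w2]; apply: le_trans (enormB_le _ _) _; rewrite !enorm_axis.
      by rewrite [X in _ + X]ger0_norm; [have : `|w| <= 3/4 by apply/ler_normlP; split; lra|]; lra.
    have h : `|dot (F (axis k u) - F (axis k v)) (frame_vector (F := F) i) - 0| <= 12 * e.
      rewrite subr0; apply: (gauged_dot_equidistant H) => //; rewrite ?q ?enorm_axis_equidistant//;
        apply: (gauged_axis H); lra.
    have := dot_frame_close (gauged_half H) (gauged_le3 H Du Dv uv) (uo i) h.
    by rewrite mulr0 subr0 /K; lra.
  by apply/ler_normlP; split; lra.
move=> s t s0 t0 st.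
have gb w : 0 <= w -> w <= s + t -> 0 <= g w <= g (s + t).
  move=> w0 wst; rewrite (gauged_mono H) ?w0// andbT.
  by have /andP[] : 0 <= g w <= 2 by apply: (gauged_bound H); lra.
set p := F (axis k (s - 3/4)); set q := F (axis k (- (3/4))).
set r := F (axis k (s + t - 3/4)).
have h1 : `|g s - `|dot (p - q) (o k)| | <= (d%:R * K + 1) * e.
  have := line (s - 3/4) (- (3/4)); rewrite opprK subrK (ger0_norm s0).
  by apply; lra.
have h2 : `|g t - `|dot (r - p) (o k)| | <= (d%:R * K + 1) * e.
  have := line (s + t - 3/4) (s - 3/4).
  rewrite (_ : s + t - 3/4 - (s - 3/4) = t); last by ring.
  by rewrite (ger0_norm t0); apply; lra.
have h3 : `|g (s + t) - `|dot (p - q) (o k) + dot (r - p) (o k)| | <= (d%:R * K + 1) * e.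
  rewrite -dotDl (_ : p - q + (r - p) = r - q); last by rewrite addrC addrA subrK.
  have := line (s + t - 3/4) (- (3/4)); rewrite opprK subrK (ger0_norm (addr_ge0 s0 t0)).
  by apply; lra.
have := approx_additive_abs _ _ h1 h2 h3; rewrite !gb//; lra.
Qed.

(** Hyers-Ulam on an interval. After subtracting the chord, [h] vanishes at [T]. Let [S] be the
    supremum of its absolute value: doubling bounds it by [(S + b) / 2] on the first half, and [h t]
    is within [b] of [- h (T - t)] on the second, so [S <= (S + 3 * b) / 2]. Boundedness of [f] only
    makes [S] finite. *)
Lemma approx_additive_linear (R : realType) (f : R -> R) (T B b : R) : 0 < T ->
  (forall t, 0 <= t <= T -> `|f t| <= B) ->
  (forall s t, 0 <= s -> 0 <= t -> s + t <= T -> `|f (s + t) - f s - f t| <= b) ->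
  forall t, 0 <= t <= T -> `|f t - f T / T * t| <= 3 * b.
Proof.
move=> T0 fB fb.
pose h t := f t - f T / T * t.
have hT : h T = 0 by rewrite /h divfK ?subrr// gt_eqF.
have hb s t : 0 <= s -> 0 <= t -> s + t <= T -> `|h (s + t) - h s - h t| <= b.
  move=> s0 t0 st; have := fb _ _ s0 t0 st; congr (`|_| <= _); rewrite /h; ring.
pose E := [set `|h t| | t in [set t | 0 <= t <= T]].
have E0 : E !=set0 by exists `|h 0|; exists 0 => //=; lra.
have Eb : has_ubound E.
  exists (B + `|f T / T| * T) => _ [t /= tT <-].
  apply: le_trans (ler_normB _ _) _; apply: lerD; first exact: fB.
  by rewrite normrM ler_wpM2l// ger0_norm; lra.
have hS t : 0 <= t <= T -> `|h t| <= sup E.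
  by move=> tT; apply: ub_le_sup => //; exists t.
suff S3 : sup E <= 3 * b by move=> t /hS; rewrite -/(h t); lra.
suff : sup E <= (sup E + 3 * b) / 2 by lra.
apply: ge_sup => // _ [t /= /andP[t0 tT] <-].
have b0 : 0 <= b.
  by have := hb 0 0; rewrite addr0 => /(_ (lexx _) (lexx _) (ltW T0)); exact: le_trans.
have half u : 0 <= u -> u <= T / 2 -> `|h u| <= (sup E + b) / 2.
  move=> u0 uT; have uuT : u + u <= T by lra.
  have := hb u u u0 u0 uuT; have : `|h (u + u)| <= sup E by apply: hS; lra.
  by move=> /ler_normlP[h1 h2] /ler_normlP[h3 h4]; apply/ler_normlP; split; lra.
have [t2|t2] := leP t (T / 2); first by have := half t t0 t2; lra.
have := hb t (T - t) t0; rewrite subrKC hT.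
have tt : 0 <= T - t by lra.
have tt2 : T - t <= T / 2 by lra.
move=> /(_ tt (lexx _)) /ler_normlP[h1 h2]; have /ler_normlP[h3 h4] := half _ tt tt2.
by apply/ler_normlP; split; lra.
Qed.

Lemma gauge_linear (R : realType) (d : nat) (k : 'I_d) : exists C e0 : R,
  [/\ 0 < C, 0 < e0 & forall D F g e, @gauged R d D F g e -> e <= e0 ->
    exists2 l, 0 <= l <= 4/3 & forall t, 0 <= t <= 3/2 -> `|g t - l * t| <= C * e].
Proof.
have [C [e0 [C0 e00 HS]]] := gauge_superadditive R k.
exists (3 * C), e0; split; [lra|by []|] => D F g e H he.
have gb := gauged_bound H; have := gb (3/2).
move=> /(_ ltac:(lra)) g32.
exists (g (3/2) / (3/2)); first by lra.
have T0 : 0 < 3/2 :> R by lra.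
have fB t : 0 <= t <= 3/2 -> `|g t| <= 2 by move=> /gb /andP[? ?]; rewrite ger0_norm.
by move=> t /(approx_additive_linear T0 fB (HS _ _ _ _ H he)); lra.
Qed.

(** The coordinates of [F y - F 0] in the frame are read off from the distances of [y] and [0] to
    the vertices. Hence [y] may leave the unit ball as long as these distances stay in the range of
    the gauge: [5/4 + 1/4 = 3/2]. *)
Lemma gauge_similarity (R : realType) (d : nat) (k : 'I_d) : exists C e0 : R,
  [/\ 0 < C, 0 < e0 & forall D F g e, @gauged R d D F g e -> e <= e0 ->
    exists l O, [/\ 0 <= l, O *m O^T = 1%:M & forall y, D y -> enorm y <= 5/4 ->
      enorm (F y - F 0 - l *: (y *m O)) <= C * e]].
Proof.
have [C1 [e1 [C10 e10 HF]]] := gauged_frame R d.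
have [C2 [e2 [C20 e20 HL]]] := gauge_linear R k.
(* [B] comes from the four squared distances of the polarisation, halved; [5] bounds [g t + l * t]
   once [C2 * e <= 1]; [17] exceeds [10 * (4/3) * (5/4)], the bound on [l * y_i / g (1/2)]. *)
pose B := 2 * (12 + 5 * C2); pose K := 10 * B + 3 * C1 + 17 * C2.
have K0 : 0 < K by rewrite /K /B; lra.
exists (d%:R * K + 1), (Num.min e1 (Num.min e2 C2^-1)); split.
- by have := mulr_ge0 (ler0n R d) (ltW K0); lra.
- by rewrite !lt_min e10 e20 invr_gt0.
move=> D F g e H; rewrite !le_min => /and3P[ee1 ee2 eC2].
have [ o oo uo] := HF _ _ _ _ H ee1; have [l /andP[l0 l43] gl] := HL _ _ _ _ H ee2.
have /andP[e0 _] := gauged_e H.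
have C2e : C2 * e <= 1 by have := ler_wpM2l (ltW C20) eC2; rewrite mulfV ?gt_eqF.
exists l, (family_mx o); split => //; first exact: family_mx_orthonormal.
move=> y Dy y54; have D0 : D 0.
  have h : eball 0 1 (0 : 'rV[R]_d) by rewrite /eball /= subr0 enorm0.
  exact: (gauged_ball H h).
have sq p q : D p -> D q -> enorm (p - q) <= 3/2 ->
    `|enorm (F p - F q) ^+ 2 - l ^+ 2 * enorm (p - q) ^+ 2| <= (12 + 5 * C2) * e.
  move=> Dp Dq pq; have := gauged_sqr_gauge H Dp Dq pq.
  have tb : 0 <= enorm (p - q) <= 3/2 by rewrite enorm_ge0.
  have := gl _ tb; have := gauged_bound H tb; set t := enorm (p - q); set gt := g t.
  move=> /andP[gt0 gt2] h.
  have : `|gt ^+ 2 - l ^+ 2 * t ^+ 2| <= 5 * (C2 * e).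
    rewrite -exprMn subr_sqr normrM mulrC; apply: ler_pM => //.
    by move/ler_normlP : h => [h1 h2]; apply/ler_normlP; split; nra.
  move=> /ler_normlP[h1 h2] /ler_normlP[h3 h4]; apply/ler_normlP; split; lra.
have X3 : enorm (F y - F 0) <= 3 by apply: (gauged_le3 H); rewrite ?subr0//; lra.
apply: (@le_trans _ _ (d%:R * (K * e))); last by clear -e0; lra.
apply: le_trans (enorm_le_sum_dot _ oo) _.
apply: (@le_trans _ _ (\sum_(i < d) (K * e))); last by rewrite sumr_const card_ord mulr_natl.
apply: ler_sum => i _; rewrite dotDl dotNl dotZl dot_mul_family_mx//.
have yi : `|y ord0 i| <= 5/4 by apply: le_trans (coord_le_enorm _ _) y54.
have Dq t : `|t| = 1/4 -> D (axis i t).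
  by move=> t4; apply: (gauged_axis H); rewrite -ltr_norml t4; lra.
have dq p (t : R) : enorm p <= 5/4 -> `|t| = 1/4 -> enorm (p - axis i t) <= 3/2.
  by move=> hp t4; apply: le_trans (enormB_le _ _) _; rewrite enorm_axis t4; lra.
have n1 : `|1/4 : R| = 1/4 by rewrite ger0_norm; lra.
have n2 : `|- (1/4) : R| = 1/4 by rewrite normrN.
have z54 : enorm (0 : 'rV[R]_d) <= 5/4 by rewrite enorm0; lra.
have h : `|dot (F y - F 0) (frame_vector (F := F) i) - l ^+ 2 * y ord0 i / 2| <= B * e.
  have := dot_polar4 (F y) (F 0) (F (axis i (1/4))) (F (axis i (- (1/4)))).
  have := sq _ _ Dy (Dq _ n1) (dq _ _ y54 n1); have := sq _ _ Dy (Dq _ n2) (dq _ _ y54 n2).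
  have := sq _ _ D0 (Dq _ n1) (dq _ _ z54 n1); have := sq _ _ D0 (Dq _ n2) (dq _ _ z54 n2).
  rewrite !sub0r !enormN !enorm_axis n1 n2.
  have -> : enorm (y - axis i (1/4)) ^+ 2 = enorm y ^+ 2 - y ord0 i / 2 + 1/16.
    by rewrite !enorm_sqr !(dotDl, dotDr, dotNl, dotNr) dot_axis eqxx (dotC (axis _ _)) dot_axisr /=; field.
  have -> : enorm (y - axis i (- (1/4))) ^+ 2 = enorm y ^+ 2 + y ord0 i / 2 + 1/16.
    by rewrite !enorm_sqr !(dotDl, dotDr, dotNl, dotNr) dot_axis eqxx (dotC (axis _ _)) dot_axisr /=; field.
  rewrite /frame_vector; clear => /ler_normlP[h1 h2] /ler_normlP[h3 h4] /ler_normlP[h5 h6].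
  by move=> /ler_normlP[h7 h8] h9; rewrite /B; apply/ler_normlP; split; lra.
have := dot_frame_close (gauged_half H) X3 (uo i) h.
(* Polarisation yields [l ^ 2 * y_i / 2]; dividing by [g (1/2)], which is close to [l / 2], turns it
   into [l * y_i]. *)
have : `|(g (1/2))^-1 * (l ^+ 2 * y ord0 i / 2) - l * y ord0 i| <= 17 * (C2 * e).
  have G1 := gauged_half H; set G := g (1/2) in G1 *.
  have -> : G^-1 * (l ^+ 2 * y ord0 i / 2) - l * y ord0 i = G^-1 * l * y ord0 i * (l * (1/2) - G).
    by field; rewrite gt_eqF//; lra.
  have hG : `|l * (1/2) - G| <= C2 * e by rewrite distrC; apply: gl; lra.
  have G0 : 0 <= G^-1 by rewrite invr_ge0; lra.
  have G10 : G^-1 <= 10 by rewrite -[leRHS]invrK lef_pV2 ?posrE//; lra.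
  rewrite !normrM (ger0_norm G0) (ger0_norm l0); apply: ler_pM => //; first by rewrite !mulr_ge0.
  have h1 : G^-1 * l <= 10 * (4/3) by exact: ler_pM.
  have := ler_pM (mulr_ge0 G0 l0) (normr_ge0 _) h1 yi; lra.
move=> /ler_normlP[h1 h2] /ler_normlP[h3 h4]; rewrite /K; apply/ler_normlP; split; lra.
Qed.

(** * Cubic grids and pigeonhole *)

Lemma exists_cells (R : realType) (d k : nat) (B : R) : 0 < B ->
  exists c : 'rV[R]_d -> {ffun 'I_d -> 'I_k.+1}, forall x y, enorm x < B -> enorm y < B ->
    c x = c y -> enorm (x - y) <= d%:R * (2 * B / k.+1%:R).
Proof.
move=> B0; have k0 : 0 < k.+1%:R :> R by rewrite ltr0n.
pose u (x : 'rV[R]_d) i := (x ord0 i + B) / (2 * B) * k.+1%:R.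
have ub x i : enorm x < B -> 0 <= u x i < k.+1%:R.
  move=> xB; have := le_lt_trans (coord_le_enorm x i) xB; rewrite ltr_norml => /andP[h1 h2].
  rewrite /u mulr_ge0 ?divr_ge0//=; try lra.
  by rewrite gtr_pMl// ltr_pdivrMr; lra.
(* The cells cut the cube of half-side [B] into [k.+1] slices per direction. The default of [inord]
   is reached only outside the ball considered. *)
exists (fun x => [ffun i => inord (Num.truncn (u x i))]) => x y xB yB /ffunP cxy.
apply: enorm_le_coord => i; have := congr1 val (cxy i); rewrite !ffunE !mxE /=.
have /andP[ux0 uxk] := ub _ i xB; have /andP[uy0 uyk] := ub _ i yB.
rewrite !inordK ?truncn_lt_nat// => e.
have := truncn_itv ux0; have := truncn_itv uy0; rewrite e.
set n := Num.truncn _ => /andP[h1 h2] /andP[h3 h4].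
have -> : x ord0 i - y ord0 i = (u x i - u y i) * (2 * B / k.+1%:R).
  by rewrite /u; field; rewrite gt_eqF//= gt_eqF.
have BK : 0 < 2 * B / k.+1%:R by rewrite divr_gt0//; lra.
rewrite normrM (gtr0_norm BK) ger_pMl//; rewrite -natr1 in h2 h4.
by apply/ler_normlP; split; lra.
Qed.

Lemma pigeonhole_cells (R : realType) (d m : nat) (B : R) (psi : {ffun 'I_d -> 'I_m.+2} -> 'rV[R]_d) :
  (0 < d)%N -> 0 < B -> (forall f, enorm (psi f) < B) ->
  exists f f', f != f' /\ enorm (psi f - psi f') <= d%:R * (2 * B / m.+1%:R).
Proof.
move=> d0 B0 hB; have [c hc] := @exists_cells R d m B B0.
have : ~~ injectiveb (c \o psi).
  (* There are [m.+2 ^ d] labels for [m.+1 ^ d] cells, a strict excess because [d > 0]. *)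
  by apply/injectiveP => /leq_card; rewrite !card_ffun !card_ord leq_exp2r// ltnn.
move=> /injectivePn[f [f' ff' e]].
by exists f, f'; split => //; exact: hc.
Qed.

(** Isotonicity holds on twice the ball where [A] is dense, so that pairs outside the unit ball can
    be compared with pairs inside it. No lower bound on the images is included, which leaves room
    for the case of a constant image. *)
Record normalised {R : realType} {d : nat} (A : set 'rV[R]_d) (phi : 'rV[R]_d -> 'rV[R]_d)
    (eps : R) : Prop := Normalised {
  normalised_eps : 0 < eps <= 1/100;
  normalised_dense : forall y, enorm y < 1 -> exists2 p, A p & enorm (y - p) < eps;
  normalised_isotonic : isotonic phi (A `&` eball 0 2);
  normalised_le1 : forall p q, A p -> A q -> enorm p < 1 -> enorm q < 1 ->
    enorm (phi p - phi q) <= 1 }.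

(** * Isotonic maps on an approximately dense subset of the unit ball *)

Section Normalised.
Context {R : realType} {d : nat} {A : set 'rV[R]_d} {phi : 'rV[R]_d -> 'rV[R]_d} {eps : R}.
Context (H : normalised A phi eps) (k : 'I_d).
Implicit Types (p q y z : 'rV[R]_d) (t : R).


Lemma normalised_iso p q p' q' : A p -> A q -> A p' -> A q' ->
  enorm p < 2 -> enorm q < 2 -> enorm p' < 2 -> enorm q' < 2 ->
  enorm (p - q) < enorm (p' - q') -> enorm (phi p - phi q) <= enorm (phi p' - phi q').
Proof.
by move=> *; apply: (normalised_isotonic H) => //; split; rewrite // /eball /= subr0.
Qed.

Lemma normalised_axis t : -1 < t < 1 ->
  exists p, [/\ A p, enorm (axis k t - p) < eps & enorm p < `|t| + eps].
Proof.
move=> t1; have [|p Ap hp] := @normalised_dense _ _ _ _ _ H (axis k t).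
  by rewrite enorm_axis ltr_norml.
exists p; split => //; rewrite -(subKr (axis k t) p).
by apply: le_lt_trans (enormB_le _ _) _; rewrite enorm_axis ltrD2l.
Qed.

Lemma near_dist_lt y z p q (a b : R) : enorm (y - p) < a -> enorm (z - q) < a ->
  enorm (y - z) <= b -> enorm (p - q) < b + 2 * a.
Proof.
move=> h1 h2 h3; have := enorm_triangle y p q; have := enorm_triangle z y q.
rewrite (enorm_distC p y); lra.
Qed.

Lemma near_dist_gt y z p q (a b : R) : enorm (y - p) < a -> enorm (z - q) < a ->
  b <= enorm (y - z) -> b - 2 * a < enorm (p - q).
Proof.
move=> h1 h2 h3; have := enorm_triangle p y z; have := enorm_triangle q p z.
rewrite (enorm_distC q z); lra.
Qed.

(** Two points of [A] near [-17/20] and [17/20] on an axis lie in the unit ball and are more than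
    [8/5] apart, so isotonicity passes their bound on to [p] and [q]. *)
Lemma normalised_bound p q : A p -> A q -> enorm p < 2 -> enorm q < 2 ->
  enorm (p - q) < 8/5 -> enorm (phi p - phi q) <= 1.
Proof.
move=> Ap Aq p2 q2 pq; have /andP[eps0 eps1] := normalised_eps H.
have [|p' [Ap' hp' p'2]] := @normalised_axis (17/20); first by lra.
have [|q' [Aq' hq' q'2]] := @normalised_axis (- (17/20)); first by lra.
rewrite normrN in q'2; rewrite ger0_norm in p'2 q'2; try lra.
apply: le_trans (normalised_iso Ap Aq Ap' Aq' p2 q2 _ _ _) _; try lra.
  have h : 17/10 <= enorm (axis k (17/20) - axis k (- (17/20)) : 'rV[R]_d).
    by rewrite enorm_axisB ger0_norm; lra.
  by have := near_dist_gt hp' hq' h; lra.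
by apply: (normalised_le1 H) => //; lra.
Qed.

(** Many points of [A] in the unit ball are more than [8 * eps] apart, yet their images share a
    bounded region, so two of these images are within [O(eps)]. By isotonicity no pair closer than
    [8 * eps] has images farther apart. *)
Lemma normalised_packing p q : eps <= (80 * d%:R)^-1 ->
  A p -> A q -> enorm p < 2 -> enorm q < 2 -> enorm (p - q) < 8 * eps ->
  enorm (phi p - phi q) <= 160 * d%:R ^+ 2 * eps.
Proof.
move=> epsd Ap Aq p2 q2 pq; have /andP[eps0 eps1] := normalised_eps H.
have d0 : (0 < d)%N by apply: leq_ltn_trans (ltn_ord k).
have dR : 0 < d%:R :> R by rewrite ltr0n.
(* A grid of mesh [10 * eps] with [a] steps per side stays within norm [d * a * 10 * eps = 1/2]. As
   [a >= 4], truncation and the loss of one cell cost at most a factor 2: [m.+1 >= a / 2]. *)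
pose a := (20 * d%:R * eps)^-1.
have a0 : 0 < a by rewrite invr_gt0 !mulr_gt0//; lra.
have aE : a * (20 * d%:R * eps) = 1 by rewrite mulVf// gt_eqF// !mulr_gt0//; lra.
have a4 : 4 <= a.
  have : eps * (80 * d%:R) <= 1.
    have h80 : 0 < 80 * d%:R :> R by rewrite mulr_gt0//; lra.
    by have := ler_wpM2r (ltW h80) epsd; rewrite mulVf// gt_eqF.
  move=> h80; have h20 : 20 * d%:R * eps <= 1/4 by lra.
  have : 0 < 20 * d%:R * eps by rewrite !mulr_gt0//; lra.
  by move: aE h20; set b := 20 * _ * _; clear => aE b4 b0; nra.
have /andP[n1 n2] := truncn_itv (ltW a0).
case: (Num.truncn a) n1 n2 => [|[|m]] n1 n2; [lra|lra|].
have m1 : a / 2 <= m.+1%:R by move: n2; rewrite -natr1 -natr1; lra.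
pose y (f : {ffun 'I_d -> 'I_m.+2}) : 'rV[R]_d := \row_i ((f i)%:R * (10 * eps)).
have yf f : enorm (y f) <= 1/2.
  have -> : 1/2 = d%:R * (a * (10 * eps)) by have := aE; lra.
  apply: enorm_le_coord => i; rewrite mxE ger0_norm ?mulr_ge0//; try lra.
  rewrite ler_wpM2r//; first lra.
  by apply: le_trans n1; rewrite ler_nat ltnW.
have yff f f' : f != f' -> 10 * eps <= enorm (y f - y f').
  move=> ff'; have [i fi] : exists i, f i != f' i.
    by apply/existsP; apply: contraNT ff'; rewrite negb_exists => /forallP h;
      apply/eqP/ffunP => i; apply/eqP; have := h i; rewrite negbK.
  apply: le_trans (coord_le_enorm _ i); rewrite !mxE -mulrBl normrM (@ger0_norm _ (10 * eps)); last lra.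
  rewrite ler_peMl//; first lra.
  move: fi; rewrite -val_eqE neq_ltn => /orP[] lt.
    by rewrite distrC ger0_norm ?subr_ge0 ?ler_nat 1?ltnW// lerBrDl natr1 ler_nat.
  by rewrite ger0_norm ?subr_ge0 ?ler_nat 1?ltnW// lerBrDl natr1 ler_nat.
have /choice[P hP] f : exists p, A p /\ enorm (y f - p) < eps.
  by have [|p' ? ?] := @normalised_dense _ _ _ _ _ H (y f); [have := yf f; lra|exists p'].
have P1 f : enorm (P f) < 1.
  have [_ h1] := hP f; have := enormB_le (y f) (y f - P f); rewrite subKr; have := yf f; lra.
have [f0] : inhabited {ffun 'I_d -> 'I_m.+2} by split; exact: [ffun=> ord0].
have psiB f : enorm (phi (P f) - phi (P f0)) < 2.
  by apply: le_lt_trans (normalised_le1 H _ _ _ _) _ => //; first [by case: (hP f)|by case: (hP f0)|lra].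
have [f [f' [ff' h]]] := pigeonhole_cells d0 (ltac:(lra) : 0 < 2 :> R) psiB.
have [Af hf] := hP f; have [Af' hf'] := hP f'.
have Pd := near_dist_gt hf hf' (yff _ _ ff').
apply: le_trans (normalised_iso Ap Aq Af Af' _ _ _ _ _) _ => //; try lra.
- by have := P1 f; lra.
- by have := P1 f'; lra.
move: h; rewrite opprB addrA subrK; move/le_trans; apply.
have m0 : 0 < m.+1%:R :> R by rewrite ltr0n.
rewrite mulrA ler_pdivrMr//.
have h1 : 0 < d%:R ^+ 2 * eps by rewrite mulr_gt0// exprn_gt0.
have := ler_wpM2l (ltW h1) m1.
have -> : d%:R ^+ 2 * eps * (a / 2) = d%:R / 40 by move: aE => /(congr1 (fun w : R => w * d%:R / 40)); lra.
lra.
Qed.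

End Normalised.

(** Isotonicity gives a matching lower bound: the images of a pair at distance at least [t] are at
    least this far apart. The value 0 keeps the set nonempty when no pair is closer than [t]. *)
Definition image_gauge {R : realType} {d : nat} (A : set 'rV[R]_d) (phi : 'rV[R]_d -> 'rV[R]_d)
    (t : R) : R :=
  sup [set r | r = 0 \/ exists p q, [/\ A p, A q, enorm p < 2 /\ enorm q < 2,
    enorm (p - q) < t & r = enorm (phi p - phi q)]].

(** * The gauge of an isotonic map *)

Section ImageGauge.
Context {R : realType} {d : nat} {A : set 'rV[R]_d} {phi : 'rV[R]_d -> 'rV[R]_d} {eps : R}.
Context (H : normalised A phi eps) (k : 'I_d).
Implicit Types (p q y z : 'rV[R]_d) (t c : R).
Let g := image_gauge A phi.

Lemma image_gauge_le t c : 0 <= c ->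
  (forall p q, A p -> A q -> enorm p < 2 -> enorm q < 2 -> enorm (p - q) < t ->
    enorm (phi p - phi q) <= c) -> g t <= c.
Proof.
move=> c0 h; apply: ge_sup; first by exists 0; left.
by move=> _ [->//|[p [q [Ap Aq [p2 q2] pq ->]]]]; apply: h.
Qed.

Lemma has_ubound_image_gauge t : t <= 8/5 -> has_ubound [set r | r = 0 \/
  exists p q, [/\ A p, A q, enorm p < 2 /\ enorm q < 2, enorm (p - q) < t
    & r = enorm (phi p - phi q)]].
Proof.
move=> t85; exists 1 => _ [->|[p [q [Ap Aq [p2 q2] pq ->]]]]; first exact: ler01.
by apply: (normalised_bound H k) => //; lra.
Qed.

Lemma le_image_gauge t p q : t <= 8/5 -> A p -> A q -> enorm p < 2 -> enorm q < 2 ->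
  enorm (p - q) < t -> enorm (phi p - phi q) <= g t.
Proof.
move=> t85 Ap Aq p2 q2 pq; apply: ub_le_sup; first exact: has_ubound_image_gauge.
by right; exists p, q.
Qed.

Lemma image_gauge_ge0 t : t <= 8/5 -> 0 <= g t.
Proof.
by move=> t85; apply: ub_le_sup; [exact: has_ubound_image_gauge|left].
Qed.

Lemma image_gauge_le1 t : t <= 8/5 -> g t <= 1.
Proof.
move=> t85; apply: image_gauge_le => [|p q Ap Aq p2 q2 pq]; first exact: ler01.
by apply: (normalised_bound H k) => //; lra.
Qed.

Lemma image_gauge_mono s t : s <= t -> t <= 8/5 -> g s <= g t.
Proof.
move=> st t85; apply: image_gauge_le => [|p q Ap Aq p2 q2 pq]; first exact: image_gauge_ge0.
by apply: le_image_gauge => //; lra.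
Qed.

Lemma image_gauge_le_dist t p q : A p -> A q -> enorm p < 2 -> enorm q < 2 ->
  t <= enorm (p - q) -> g t <= enorm (phi p - phi q).
Proof.
move=> Ap Aq p2 q2 pq; apply: image_gauge_le => [|p' q' *]; first exact: enorm_ge0.
by apply: (normalised_iso H) => //; lra.
Qed.

(** The path through [6/10 p], [2/10 p], [2/10 q], [6/10 q] joins [p] to [q] in five hops of length
    at most [4/10], hence less than [1/2] after moving to points of [A]. One hop must carry a fifth
    of the image distance. *)
Lemma image_gauge_half p q : A p -> A q -> enorm p < 1 -> enorm q < 1 ->
  1/2 <= enorm (phi p - phi q) -> 1/10 <= g (1/2).
Proof.
move=> Ap Aq p1 q1 hpq; have /andP[e0 e1] := normalised_eps H.
have near y c : 0 <= c -> c < 1 -> enorm y < 1 ->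
    exists p, [/\ A p, enorm p < 2 & enorm (c *: y - p) < eps].
  move=> c0 c1 y1; have cy : enorm (c *: y) < 1.
    rewrite enormZ ger0_norm//; have := ler_wpM2l c0 (ltW y1); lra.
  have [p' Ap' hp'] := normalised_dense H cy; exists p'; split => //.
  by have := enormB_le (c *: y) (c *: y - p'); rewrite subKr; lra.
have step p' q' y z : A p' -> A q' -> enorm p' < 2 -> enorm q' < 2 ->
    enorm (y - p') < eps -> enorm (z - q') < eps -> enorm (y - z) <= 4/10 ->
    enorm (phi p' - phi q') <= g (1/2).
  move=> Ap' Aq' p'2 q'2 h1 h2 h3; apply: le_image_gauge => //; first lra.
  by have := near_dist_lt h1 h2 h3; lra.
have sc y a b : enorm y < 1 -> `|a - b| <= 4/10 -> enorm (a *: y - b *: y) <= 4/10.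
  move=> y1 ab; rewrite -scalerBl enormZ.
  by have := ler_pM (normr_ge0 _) (enorm_ge0 _) ab (ltW y1); lra.
have ab1 : `|1 - 6/10 : R| <= 4/10 by rewrite ger0_norm; lra.
have ab2 : `|6/10 - 2/10 : R| <= 4/10 by rewrite ger0_norm; lra.
have [|//|p3 [Ap3 p32 hp3]] := near p (6/10) _ _ p1; [lra|lra|].
have [|//|p4 [Ap4 p42 hp4]] := near p (2/10) _ _ p1; [lra|lra|].
have [|//|q3 [Aq3 q32 hq3]] := near q (6/10) _ _ q1; [lra|lra|].
have [|//|q4 [Aq4 q42 hq4]] := near q (2/10) _ _ q1; [lra|lra|].
have pp : enorm (1 *: p - p) < eps by rewrite scale1r subrr enorm0.
have qq : enorm (1 *: q - q) < eps by rewrite scale1r subrr enorm0.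
have p2 : enorm p < 2 by lra.
have q2 : enorm q < 2 by lra.
have h1 := step _ _ _ _ Ap Ap3 p2 p32 pp hp3 (sc _ _ _ p1 ab1).
have h2 := step _ _ _ _ Ap3 Ap4 p32 p42 hp3 hp4 (sc _ _ _ p1 ab2).
have h4 := step _ _ _ _ Aq Aq3 q2 q32 qq hq3 (sc _ _ _ q1 ab1).
have h5 := step _ _ _ _ Aq3 Aq4 q32 q42 hq3 hq4 (sc _ _ _ q1 ab2).
have h3 : enorm (phi p4 - phi q4) <= g (1/2).
  apply: (step _ _ _ _ Ap4 Aq4 p42 q42 hp4 hq4); rewrite -scalerBr enormZ ger0_norm; last lra.
  by have := enormB_le p q; lra.
rewrite (enorm_distC (phi q) _) in h4; rewrite (enorm_distC (phi q3) _) in h5.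
have := enorm_triangle (phi p3) (phi p) (phi q); have := enorm_triangle (phi p4) (phi p3) (phi q).
have := enorm_triangle (phi q4) (phi p4) (phi q); have := enorm_triangle (phi q3) (phi q4) (phi q).
lra.
Qed.

Let C := 160 * d%:R ^+ 2 : R.

(** A pair near an axis, slightly more than [t + 2 * eps] apart, dominates all pairs in question. An
    intermediate point [m] of [A] splits it into a part shorter than [t] and one shorter than
    [8 * eps], to which the packing bound applies. For [t < 2 * eps] packing alone suffices. *)
Lemma image_gauge_continuity t : eps <= (80 * d%:R)^-1 -> 0 <= t <= 31/20 ->
  g (t + 2 * eps) <= g t + C * eps.
Proof.
move=> epsd /andP[t0 t1]; have /andP[e0 e1] := normalised_eps H.
have C0 : 0 <= C by rewrite mulr_ge0// exprn_ge0.
have Ce0 : 0 <= C * eps by rewrite mulr_ge0// ltW.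
have gt0 : 0 <= g t by apply: image_gauge_ge0; lra.
apply: image_gauge_le => [|p q Ap Aq p2 q2 pq]; first by lra.
have [te|te] := ltP t (2 * eps).
  have : enorm (p - q) < 8 * eps by lra.
  by move=> /(normalised_packing H k epsd Ap Aq p2 q2); rewrite -/C; lra.
have [|p1 [Ap1 hp1 p12]] := @normalised_axis _ _ _ _ _ H k (- (t / 2 + 2 * eps)); first by lra.
have [|q1 [Aq1 hq1 q12]] := @normalised_axis _ _ _ _ _ H k (t / 2 + 2 * eps); first by lra.
have [|m [Am hm m2]] := @normalised_axis _ _ _ _ _ H k (t / 2 - 4 * eps); first by lra.
have {}m2 : enorm m < 2.
  have : `|t / 2 - 4 * eps| <= 1 by apply/ler_normlP; split; lra.
  by lra.
have a0 : 0 <= t / 2 + 2 * eps by lra.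
rewrite normrN in p12; rewrite (ger0_norm a0) in p12 q12.
have d1 : t + 4 * eps <= enorm (axis k (- (t / 2 + 2 * eps)) - axis k (t / 2 + 2 * eps) : 'rV[R]_d).
  by rewrite enorm_axisB distrC ger0_norm; lra.
have d2 : enorm (axis k (- (t / 2 + 2 * eps)) - axis k (t / 2 - 4 * eps) : 'rV[R]_d) <= t - 2 * eps.
  by rewrite enorm_axisB distrC ger0_norm; lra.
have d3 : enorm (axis k (t / 2 - 4 * eps) - axis k (t / 2 + 2 * eps) : 'rV[R]_d) <= 6 * eps.
  by rewrite enorm_axisB distrC ger0_norm; lra.
have e1' := near_dist_gt hp1 hq1 d1; have e2 := near_dist_lt hp1 hm d2.
have e3 := near_dist_lt hm hq1 d3.
have h1 : enorm (phi p - phi q) <= enorm (phi p1 - phi q1).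
  by apply: (normalised_iso H) => //; lra.
have h2 : enorm (phi p1 - phi m) <= g t by apply: le_image_gauge => //; lra.
have h3 : enorm (phi m - phi q1) <= C * eps.
  by apply: (normalised_packing H k) => //; lra.
by have := enorm_triangle (phi m) (phi p1) (phi q1); lra.
Qed.

Lemma normalised_gauged : 1/10 <= g (1/2) -> eps <= (80 * d%:R)^-1 -> C * eps <= 1 ->
  exists2 F : 'rV[R]_d -> 'rV[R]_d, forall p, A p -> F p = phi p
    & gauged (eball 0 1 `|` (A `&` [set p | enorm p <= 5/4])) F g (C * eps).
Proof.
move=> ghalf epsd Ce1; have /andP[e0 e1] := normalised_eps H.
have C0 : 0 <= C by rewrite mulr_ge0// exprn_ge0.
have Ce0 : 0 <= C * eps by rewrite mulr_ge0// ltW.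
have /choice[P hP] y : exists p, (A y -> p = y) /\
    ((eball 0 1 `|` (A `&` [set p | enorm p <= 5/4])) y ->
      [/\ A p, enorm p < 2 & enorm (y - p) < eps]).
  have [Ay|nAy] := pselect (A y).
    exists y; split=> // h; split => //; last by rewrite subrr enorm0.
    by case: h => [|[_]]; rewrite /eball /= ?subr0; lra.
  have [y1|y1] := ltP (enorm y) 1.
    have [p Ap hp] := normalised_dense H y1; exists p; split=> [//|_]; split => //.
    by have := enormB_le y (y - p); rewrite subKr; lra.
  by exists 0; split=> [//|[|[//]]]; rewrite /eball /= subr0; lra.
exists (phi \o P) => [p Ap|]; first by rewrite /=; have [->] := hP p.
split.
- by rewrite Ce0.
- by move=> y; left.
- by move=> s t /andP[s0 st] t32; apply: image_gauge_mono => //; lra.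
- move=> t /andP[t0 t1]; rewrite image_gauge_ge0/=; last lra.
  by apply: le_trans (image_gauge_le1 _) _; lra.
- exact: ghalf.
move=> y z Dy Dz yz /=.
have [_ /(_ Dy)[Ap p2 hp]] := hP y; have [_ /(_ Dz)[Aq q2 hq]] := hP z.
set t := enorm (y - z) in yz *; have t0 : 0 <= t by exact: enorm_ge0.
have d1 := near_dist_lt hp hq (lexx t); have d2 := near_dist_gt hp hq (lexx t).
have t85 : t + 2 * eps <= 8/5 by lra.
have t31 : 0 <= t <= 31/20 by lra.
have h1 : enorm (phi (P y) - phi (P z)) <= g t + C * eps.
  by apply: le_trans (le_image_gauge t85 Ap Aq p2 q2 d1) _; exact: image_gauge_continuity.
have h2 : g t - C * eps <= enorm (phi (P y) - phi (P z)).
  have [te|te] := ltP t (2 * eps).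
    have : g t <= C * eps.
      apply: image_gauge_le => // p q Ap' Aq' p2' q2' pq.
      by apply: (normalised_packing H k) => //; lra.
    by have := enorm_ge0 (phi (P y) - phi (P z)); lra.
  have h := image_gauge_le_dist Ap Aq p2 q2 (ltW d2).
  by have := @image_gauge_continuity (t - 2 * eps) epsd; rewrite subrK; lra.
by apply/ler_normlP; split; lra.
Qed.

End ImageGauge.

Lemma normalised_similarity (R : realType) (d : nat) (k : 'I_d) : exists C e0 : R,
  [/\ 0 < C, 0 < e0 & forall A phi eps, @normalised R d A phi eps -> eps <= e0 ->
    (exists p q, [/\ A p, A q, enorm p < 1, enorm q < 1 & 1/2 <= enorm (phi p - phi q)]) ->
    exists b l O, [/\ 0 <= l, O *m O^T = 1%:M & forall p, A p -> enorm p <= 5/4 ->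
      enorm (phi p - b - l *: (p *m O)) <= C * eps]].
Proof.
have [C1 [e1 [C10 e10 HS]]] := gauge_similarity R k.
have d0 : 0 < d%:R :> R by rewrite ltr0n (leq_ltn_trans _ (ltn_ord k)).
pose C := 160 * d%:R ^+ 2 : R.
have C0 : 0 < C by rewrite mulr_gt0// exprn_gt0.
exists (C1 * C), (Num.min (80 * d%:R)^-1 (Num.min C^-1 (C^-1 * e1))); split.
- exact: mulr_gt0.
- have CV : 0 < C^-1 by rewrite invr_gt0.
  have dV : 0 < (80 * d%:R)^-1 :> R by rewrite invr_gt0 mulr_gt0.
  by rewrite !lt_min CV dV mulr_gt0.
move=> A phi eps H; rewrite !le_min => /and3P[he1 he2 he3] [p [q [Ap Aq p1 q1 hpq]]].
have Ce1 : C * eps <= 1 by have := ler_wpM2l (ltW C0) he2; rewrite mulfV// gt_eqF.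
have Ce2 : C * eps <= e1 by have := ler_wpM2l (ltW C0) he3; rewrite mulVKf// gt_eqF.
have [F FE HF] := normalised_gauged H k (image_gauge_half H k Ap Aq p1 q1 hpq) he1 Ce1.
have [l [ O [l0 OO hl]]] := HS _ _ _ _ HF Ce2.
exists (F 0), l, O; split => // y Ay y54; rewrite -FE// -mulrA; apply: hl => //.
by right.
Qed.

Lemma near_max (R : realType) (E : set R) (b : R) : E !=set0 -> (forall x, E x -> 0 <= x <= b) ->
  exists2 x, E x & forall y, E y -> y <= 2 * x.
Proof.
move=> E0 Eb; have hE : has_sup E by split => //; exists b => x /Eb /andP[].
have sE y : E y -> y <= sup E by move=> Ey; apply: ub_le_sup => //; case: hE.
have [s0|s0] := leP (sup E) 0.
  by have [x Ex] := E0; exists x => // y /sE; have /andP[x0 _] := Eb _ Ex; lra.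
have s2 : 0 < sup E / 2 by lra.
have [x Ex hx] := sup_adherent s2 hE.
by exists x => // y /sE; lra.
Qed.

(** * Local similarities on balls of any radius *)

Section Rescale.
Context {R : realType} {d : nat} (A : set 'rV[R]_d) (phi : 'rV[R]_d -> 'rV[R]_d).
Context (z : 'rV[R]_d) (s eps M : R).

Definition rescaled_set : set 'rV[R]_d := [set y | A (z + s *: y)].
Definition rescaled_map (y : 'rV[R]_d) := M^-1 *: phi (z + s *: y).

Lemma enorm_rescale y y' : 0 < s -> enorm ((z + s *: y) - (z + s *: y')) = s * enorm (y - y').
Proof. by move=> s0; rewrite opprD addrACA subrr add0r -scalerBr enormZ gtr0_norm. Qed.

Lemma enorm_rescale_center y : 0 < s -> enorm (z + s *: y - z) = s * enorm y.
Proof. by move=> s0; rewrite addrC addKr enormZ gtr0_norm. Qed.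

Lemma rescaled_map_dist y y' : 0 < M ->
  enorm (rescaled_map y - rescaled_map y') = M^-1 * enorm (phi (z + s *: y) - phi (z + s *: y')).
Proof. by move=> M0; rewrite -scalerBr enormZ gtr0_norm ?invr_gt0. Qed.

Lemma rescaled_normalised : 0 < s -> 0 < M -> 0 < eps <= s / 100 ->
  (forall y, eball z s y -> exists2 p, A p & enorm (y - p) < eps) ->
  isotonic phi (A `&` eball z (2 * s)) ->
  (forall p q, A p -> A q -> eball z s p -> eball z s q -> enorm (phi p - phi q) <= M) ->
  normalised rescaled_set rescaled_map (eps / s).
Proof.
move=> s0 M0 /andP[e0 e1] dense iso bound; split.
- by rewrite divr_gt0//= ler_pdivrMr//; lra.
- move=> y y1; have [|p Ap hp] := dense (z + s *: y).
    by rewrite /eball /= enorm_rescale_center// gtr_pMr.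
  have pE : z + s *: (s^-1 *: (p - z)) = p.
    by rewrite scalerA mulfV ?gt_eqF// scale1r addrC subrK.
  exists (s^-1 *: (p - z)); first by rewrite /rescaled_set /= pE.
  by rewrite ltr_pdivlMr// mulrC -enorm_rescale// pE.
- move=> x y x' y' [Ax x2] [Ay y2] [Ax' x'2] [Ay' y'2] lt.
  rewrite !rescaled_map_dist// ler_pM2l ?invr_gt0//.
  have b w : eball 0 2 w -> eball z (2 * s) (z + s *: w).
    by rewrite /eball /= subr0 enorm_rescale_center// mulrC => w2; rewrite ltr_pM2r.
  apply: iso; rewrite ?enorm_rescale ?ltr_pM2l//; split => //; exact: b.
- move=> p q Ap Aq p1 q1; rewrite rescaled_map_dist// mulrC ler_pdivrMr// mul1r.
  by apply: bound => //; rewrite /eball /= enorm_rescale_center// gtr_pMr.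
Qed.

End Rescale.

(** The error is proportional to [M], any bound on the image of the ball, as the final exponent
    requires. The margin [5/4] lets neighbouring centers, up to [2 * s] apart, share a ball of
    radius [s / 8] contained in the ball of radius [s] around one of them. *)
Lemma local_affine (R : realType) (d : nat) (k : 'I_d) : exists C e0 : R,
  [/\ 0 < C, 0 < e0 & forall (A : set 'rV[R]_d) phi z s eps M,
    0 < s -> 0 < eps <= e0 * s ->
    (forall y, eball z s y -> exists2 p, A p & enorm (y - p) < eps) ->
    isotonic phi (A `&` eball z (2 * s)) ->
    (forall p q, A p -> A q -> eball z s p -> eball z s q -> enorm (phi p - phi q) <= M) ->
    exists b l O, [/\ 0 <= l, O *m O^T = 1%:M & forall p, A p -> enorm (p - z) <= 5/4 * s ->
      enorm (phi p - (b + l *: (p *m O))) <= C * (eps / s) * M]].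
Proof.
have [C [e0 [C0 e00 HN]]] := normalised_similarity R k.
exists (2 * C), (Num.min (1/100) e0); split; [lra|by rewrite lt_min e00; lra|].
move=> A phi z s eps M s0 /andP[eps0 epsm].
have eps1 : eps <= 1/100 * s.
  by apply: le_trans epsm _; rewrite ler_pM2r// ge_min lexx.
have eps2 : eps <= e0 * s.
  by apply: le_trans epsm _; rewrite ler_pM2r// ge_min lexx orbT.
move=> dense iso bound.
have epss : 0 < eps <= s / 100 by lra.
have es : 0 < eps / s by exact: divr_gt0.
pose E := [set enorm (phi p - phi q) | p in A `&` eball z s & q in A `&` eball z s].
have zs : eball z s z by rewrite /eball /= subrr enorm0.
have [y Ay hy] : exists2 y, A y & enorm (z - y) < eps by exact: dense zs.
have ys : eball z s y by rewrite /eball /= enorm_distC; lra.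
have [||x [p [Ap ps] [q [Aq qs] xE]] xmax] := @near_max _ E M.
- by exists (enorm (phi y - phi y)); exists y => //; exists y.
- by move=> _ [p [Ap ps] [q [Aq qs] <-]]; rewrite enorm_ge0; exact: bound.
have {}xmax p' q' : A p' -> A q' -> eball z s p' -> eball z s q' -> enorm (phi p' - phi q') <= 2 * x.
  by move=> *; apply: xmax; exists p' => //; exists q'.
have xM : x <= M by rewrite -xE; exact: bound.
have rK w : z + s *: (s^-1 *: (w - z)) = w.
  by rewrite scalerA mulfV ?gt_eqF// scale1r addrC subrK.
have rb w : enorm (s^-1 *: (w - z)) = enorm (w - z) / s.
  by rewrite enormZ gtr0_norm ?invr_gt0// mulrC.
have rd w v : s^-1 *: (w - z) - s^-1 *: (v - z) = s^-1 *: (w - v).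
  by rewrite -scalerBr opprB addrA subrK.
have x0 : 0 <= x by rewrite -xE enorm_ge0.
have [{}x0|x1] := ltP 0 x; last first.
  exists (phi y), 0, 1%:M; split => //; first by rewrite trmx1 mulmx1.
  move=> w Aw ws; rewrite scale0r addr0.
  have M0 : 0 <= M by lra.
  apply: (@le_trans _ _ 0); last by rewrite !mulr_ge0// ?invr_ge0 ltW.
  (* Here all points of [A] in the ball have the same image, so any [c > 0] serves as image scale,
     and [normalised_bound] extends the equality up to radius [5/4 * s]. *)
  apply/ler_addgt0Pl => c c0; rewrite addr0.
  have hn : normalised (rescaled_set A z s) (rescaled_map phi z s c) (eps / s).
    by apply: rescaled_normalised => // p' q' Ap' Aq' h1 h2; have := xmax _ _ Ap' Aq' h1 h2; lra.
  have := @normalised_bound _ _ _ _ _ hn k (s^-1 *: (w - z)) (s^-1 *: (y - z)).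
  rewrite /rescaled_set /= !rb rd !rK rescaled_map_dist// !rK (mulrC c^-1) => /(_ Aw Ay).
  rewrite ler_pdivrMr// mul1r; apply.
  - by rewrite ltr_pdivrMr//; lra.
  - by rewrite ltr_pdivrMr// enorm_distC; lra.
  rewrite enormZ gtr0_norm ?invr_gt0// mulrC ltr_pdivrMr//.
  by have := enorm_triangle z w y; lra.
have M0 : 0 < 2 * x by lra.
have hn := rescaled_normalised s0 M0 epss dense iso xmax.
have [||b [l [ O [l0 OO hl]]]] := HN _ _ _ hn.
- by rewrite ler_pdivrMr.
- exists (s^-1 *: (p - z)), (s^-1 *: (q - z)); rewrite /rescaled_set /= !rK !rb.
  split => //; rewrite ?ltr_pdivrMr ?mul1r// rescaled_map_dist// !rK xE.
  by rewrite mulrC ler_pdivlMr//; lra.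
exists (2 * x *: b - (2 * x * l / s) *: (z *m O)), (2 * x * l / s), O; split => //.
  by rewrite !mulr_ge0// ?invr_ge0; lra.
move=> w Aw ws; have := hl (s^-1 *: (w - z)).
rewrite /rescaled_set /= rK rb ler_pdivrMr// => /(_ Aw ws).
rewrite /rescaled_map rK -scalemxAl mulmxBl.
set u := z *m O; set v := w *m O => h.
have -> : phi w - (2 * x *: b - (2 * x * l / s) *: u + (2 * x * l / s) *: v)
    = 2 * x *: ((2 * x)^-1 *: phi w - b - l *: (s^-1 *: (v - u))).
  by apply/rowP => i; rewrite !mxE; field; rewrite !gt_eqF.
rewrite enormZ gtr0_norm//; apply: le_trans (ler_wpM2l (ltW M0) h) _.
have : C * (eps / s) * x <= C * (eps / s) * M by rewrite ler_wpM2l// mulr_ge0// ltW.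
by lra.
Qed.

(** * Extrapolation of the difference of two affine maps *)

Lemma enorm_mulmx_le (R : realType) (d : nat) (x : 'rV[R]_d) (N : 'M[R]_d) :
  enorm (x *m N) <= enorm x * \sum_i enorm (row i N).
Proof.
have le (n : nat) (f : 'I_n -> 'rV[R]_d) : enorm (\sum_i f i) <= \sum_i enorm (f i).
  elim: n f => [|n IH] f; first by rewrite !big_ord0 enorm0.
  by rewrite !big_ord_recl; apply: le_trans (enormD _ _) _; rewrite lerD2l.
rewrite mulmx_sum_row mulr_sumr; apply: le_trans (le _ _) _.
by apply: ler_sum => i _; rewrite enormZ ler_wpM2r ?enorm_ge0 ?coord_le_enorm.
Qed.

(** Evaluating the difference at points of [A] near [w] and [w + axis i (r / 2)] bounds the rows of
    its linear part. Replacing these points by points of [A] costs a multiple of [eps * S], absorbed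
    on the left because [eps * (8 * d) <= r]. *)
Lemma affine_compare (R : realType) (d : nat) (A : set 'rV[R]_d) (w : 'rV[R]_d)
    (b b' : 'rV[R]_d) (L L' : 'M[R]_d) (r eps tau D : R) :
  (0 < d)%N -> 0 < r -> 0 < eps -> eps * (8 * d%:R) <= r ->
  (forall y, eball w r y -> exists2 p, A p & enorm (y - p) < eps) ->
  (forall p, A p -> eball w r p -> enorm (b + p *m L - (b' + p *m L')) <= tau) ->
  r <= D ->
  forall p, enorm (p - w) <= D ->
    enorm (b + p *m L - (b' + p *m L')) <= (1 + 16 * d%:R) * (D / r) * tau.
Proof.
move=> d0 r0 e0 er dense close rD.
have dR : 1 <= d%:R :> R by rewrite ler1n.
have er8 : eps <= r / 8 by have := ler_wpM2l (ltW e0) dR; lra.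
pose N := L - L'; pose T p := b - b' + p *m N.
have TE p : b + p *m L - (b' + p *m L') = T p.
  by rewrite /T mulmxBr opprD addrACA.
have TB p q : T p - T q = (p - q) *m N by rewrite /T opprD addrACA subrr add0r mulmxBl.
have TD p q : T p = T q + (p - q) *m N by rewrite -TB addrC subrK.
pose S := \sum_i enorm (row i N).
have S0 : 0 <= S by apply: sumr_ge0 => i _; exact: enorm_ge0.
have near y : enorm (y - w) <= r / 2 -> exists q, [/\ A q, enorm (y - q) < eps & enorm (T q) <= tau].
  move=> yw; have [|q Aq hq] := dense y; first by rewrite /eball /=; lra.
  exists q; split => //; rewrite -TE; apply: close => //; rewrite /eball /=.
  by have := enorm_triangle y q w; rewrite (enorm_distC q y); lra.
have [|a [Aa ha Ta]] := near w; first by rewrite subrr enorm0; lra.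
have rowb i : r / 2 * enorm (row i N) <= 2 * tau + 2 * eps * S.
  have [|q [Aq hq Tq]] := near (w + axis i (r / 2)).
    by rewrite addrC addKr enorm_axis ger0_norm; lra.
  pose dl := q - a - axis i (r / 2).
  have dle : enorm dl <= 2 * eps.
    have h := enorm_triangle (w + axis i (r / 2)) q (a + axis i (r / 2)).
    have E1 : q - (a + axis i (r / 2)) = dl by rewrite /dl opprD addrA.
    have E2 : w + axis i (r / 2) - (a + axis i (r / 2)) = w - a.
      by rewrite opprD addrACA subrr addr0.
    by rewrite E1 E2 (enorm_distC q) in h; lra.
  have -> : r / 2 * enorm (row i N) = enorm (axis i (r / 2) *m N).
    by rewrite /axis -scalemxAl -rowE enormZ ger0_norm//; lra.
  have -> : axis i (r / 2) *m N = T q - T a - dl *m N.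
    by rewrite TB -mulmxBl /dl subKr.
  have h1 := enormB_le (T q) (T a); have h2 := enormB_le (T q - T a) (dl *m N).
  have h3 := le_trans (enorm_mulmx_le dl N) (ler_wpM2r S0 dle).
  lra.
have Sb : S <= 8 * d%:R * tau / r.
  have : r / 2 * S <= d%:R * (2 * tau + 2 * eps * S).
    rewrite mulr_sumr; apply: (@le_trans _ _ (\sum_(i < d) (2 * tau + 2 * eps * S))).
      exact: ler_sum.
    by rewrite sumr_const card_ord (mulr_natl _ d).
  have := ler_wpM2r S0 er => h1 h2.
  rewrite ler_pdivlMr//; lra.
move=> p pw; rewrite TE (TD p a).
have tau0 : 0 <= tau by apply: le_trans Ta; exact: enorm_ge0.
have h1 := enormD (T a) ((p - a) *m N).
have pa : enorm (p - a) <= 2 * D by have := enorm_triangle w p a; lra.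
have pa0 : 0 <= 2 * D by lra.
have h2 := le_trans (enorm_mulmx_le (p - a) N) (ler_pM (enorm_ge0 _) S0 pa Sb).
have Dr : 1 <= D / r by rewrite ler_pdivlMr// mul1r.
have h3 : tau <= D / r * tau by have := ler_wpM2r tau0 Dr; rewrite mul1r.
have -> : (1 + 16 * d%:R) * (D / r) * tau = D / r * tau + 2 * D * (8 * d%:R * tau / r).
  by field; rewrite gt_eqF.
lra.
Qed.

(** * Chains of neighbouring balls *)

Section Reach.
Context {R : realType} {d : nat} (Z : set 'rV[R]_d) (sigma : R).
Implicit Types z w : 'rV[R]_d.

(** All points but the first are required to lie in [Z], which is why reversing a chain needs its
    start in [Z]. *)
Fixpoint reach (n : nat) z z' : Prop :=
  if n is m.+1 then exists w, [/\ Z w, enorm (z - w) < sigma & reach m w z'] else z = z'.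

Lemma reach_cat m n z w z' : reach m z w -> reach n w z' -> reach (m + n) z z'.
Proof.
elim: m z => [|m IH] z /=; first by move=> ->.
by move=> [v [Zv zv vw]] wz'; exists v; split=> //; exact: IH.
Qed.

Lemma reach1 z z' : Z z' -> enorm (z - z') < sigma -> reach 1 z z'.
Proof. by move=> Zz' h; exists z'. Qed.

Lemma reach_sym n z z' : Z z -> reach n z z' -> reach n z' z.
Proof.
elim: n z => [|n IH] z Zz /=; first by move=> ->.
move=> [w [Zw zw wz']]; suff : reach (n + 1) z' z by rewrite addn1.
by apply: reach_cat (IH _ Zw wz') _; apply: reach1 => //; rewrite enorm_distC.
Qed.

Lemma reach_dist (V : 'rV[R]_d -> 'rV[R]_d) (kappa : R) n z z' :
  (forall z w, Z z -> Z w -> enorm (z - w) < sigma -> enorm (V z - V w) <= kappa) ->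
  Z z -> reach n z z' -> enorm (V z - V z') <= n%:R * kappa.
Proof.
move=> h; elim: n z => [|n IH] z Zz /=; first by move=> ->; rewrite subrr enorm0 mul0r.
move=> [w [Zw zw wz']]; have := IH _ Zw wz'; have := h _ _ Zz Zw zw.
by have := enorm_triangle (V w) (V z) (V z'); rewrite -natr1; lra.
Qed.

End Reach.

Lemma open_eball (R : realType) (d : nat) (x : 'rV[R]_d) (r : R) : open (eball x r).
Proof.
rewrite openE => y; rewrite /eball /= => yr; apply/nbhs_ballP.
(* Dividing by [d.+1] leaves a strict margin when a sup-norm ball is placed inside a Euclidean one,
   and covers [d = 0]. *)
pose e := (r - enorm (y - x)) / d.+1%:R.
have e0 : 0 < e by rewrite divr_gt0 ?ltr0n// subr_gt0.
exists e => //= z [_ yz]; rewrite /eball /=.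
have : enorm (y - z) <= d%:R * e.
  by apply: enorm_le_coord => i; rewrite !mxE; exact: ltW (yz ord0 i).
have : d.+1%:R * e = r - enorm (y - x) by rewrite /e mulrCA mulfV ?mulr1// pnatr_eq0.
rewrite -natr1 mulrDl mul1r => h1 h2.
by have := enorm_triangle y z x; rewrite (enorm_distC z y); lra.
Qed.

Section Core.
Context {R : realType} {d : nat} (U : set 'rV[R]_d) (h s : R).
Context (h_gt0 : 0 < h) (s_gt0 : 0 < s) (sh : s <= h / 4).
Implicit Types y z p : 'rV[R]_d.

Definition centers : set 'rV[R]_d := [set y | eball y h `<=` U].

(* The union of the balls of radius [h - s] concentric to the balls of radius [h] in [U]. *)
Definition core : set 'rV[R]_d := [set z | exists2 y, centers y & enorm (z - y) <= h - s].

Lemma centers_core y : centers y -> core y.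
Proof.
move: h_gt0 s_gt0 sh => h0 s0 sh4.
by move=> yU; exists y => //; rewrite subrr enorm0; lra.
Qed.

Lemma eball_core z : core z -> eball z s `<=` U.
Proof.
move: h_gt0 s_gt0 sh => h0 s0 sh4; move=> [y yU zy] p; rewrite /eball /= => pz; apply: yU; rewrite /eball /=.
by have := enorm_triangle z p y; lra.
Qed.

(** Contracting the ball towards [y] by the factor [1 - s / h] moves each of its points by less than
    [s]. *)
Lemma core_near y p : centers y -> eball y h p ->
  exists z, [/\ enorm (z - y) <= h - s, core z & enorm (p - z) < s].
Proof.
move: h_gt0 s_gt0 sh => h0 s0 sh4; move=> yU; rewrite /eball /= => py; pose c := 1 - s / h.
have c0 : 0 <= c by rewrite subr_ge0 ler_pdivrMr//; lra.
have hc : c * h = h - s by rewrite mulrBl mul1r divfK// gt_eqF.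
have zy : enorm (y + c *: (p - y) - y) <= h - s.
  by rewrite addrC addKr enormZ ger0_norm// -hc ler_wpM2l// ltW.
exists (y + c *: (p - y)); split => //; first by exists y.
have -> : p - (y + c *: (p - y)) = (s / h) *: (p - y).
  by rewrite opprD addrA -{1}(scale1r (p - y)) -scalerBl subKr.
have sh0 : 0 < s / h by exact: divr_gt0.
rewrite enormZ ger0_norm ?ltW//; have := ltr_pM2l sh0 (enorm (p - y)) h.
by rewrite py divfK ?gt_eqF.
Qed.

Lemma reach_center y z : centers y -> enorm (z - y) <= h - s ->
  exists2 n, reach core (2 * s) n y z & n%:R * s <= 2 * h.
Proof.
move: h_gt0 s_gt0 sh => h0 s0 sh4; move=> yU zy; have hs0 : 0 <= h / s by rewrite divr_ge0 ?ltW.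
have /andP[n1 n2] := truncn_itv hs0; set n := (Num.truncn (h / s)).+1 in n2.
have n0 : 0 < n%:R :> R by rewrite ltr0n.
exists n; last first.
  have hh : h / s * s = h by rewrite divfK// gt_eqF.
  by have := ler_wpM2r (ltW s_gt0) n1; rewrite /n -natr1 hh; lra.
pose c (i : nat) := y + (i%:R / n%:R) *: (z - y).
have cc i : (i <= n)%N -> core (c i).
  move=> i_n; exists y => //; rewrite /c addrC addKr enormZ ger0_norm ?divr_ge0//.
  apply: le_trans zy; rewrite ler_piMl ?enorm_ge0// ler_pdivrMr// mul1r ler_nat//.
have step i : enorm (c i - c i.+1) < 2 * s.
  rewrite enorm_distC /c opprD addrACA subrr add0r -scalerBl -mulrBl -natr1 (addrC i%:R) addrK.
  rewrite enormZ ger0_norm ?divr_ge0// mul1r mulrC ltr_pdivrMr//.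
  by move: n2; rewrite ltr_pdivrMr// => n2; have := mulr_gt0 n0 s_gt0; lra.
suff H m : (m <= n)%N -> reach core (2 * s) m y (c m).
  by have := H n (leqnn n); rewrite /c mulfV ?gt_eqF// scale1r addrC subrK.
elim: m => [|m IH] mn; first by rewrite /c /= mul0r scale0r addr0.
suff : reach core (2 * s) (m + 1) y (c m.+1) by rewrite addn1.
by apply: reach_cat (IH (ltnW mn)) _; apply: reach1; [exact: cc|exact: step].
Qed.

Definition meet y y' := exists2 p, eball y h p & eball y' h p.

Lemma reach_meet y y' : centers y -> centers y' -> meet y y' ->
  exists2 n, reach core (2 * s) n y y' & n%:R * s <= 5 * h.
Proof.
move: h_gt0 s_gt0 sh => h0 s0 sh4; move=> yU y'U [p py py'].
have [z [zy Zz pz]] := core_near yU py; have [z' [zy' Zz' pz']] := core_near y'U py'.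
have [m mr mh] := reach_center yU zy; have [n nr nh] := reach_center y'U zy'.
exists (m + (1 + n))%N.
  apply: reach_cat mr (reach_cat (w := z') _ _).
    apply: reach1 => //; have := enorm_triangle p z z'; rewrite (enorm_distC z p); lra.
  by apply: reach_sym nr; exact: centers_core.
by rewrite !natrD !mulrDl; lra.
Qed.

End Core.

(** [K] is uniform in [U] and [s] because centers are sorted into cells of diameter less than [h],
    whose number depends on [d], [h] and [D] only. Balls with centers in one cell meet, and
    connectedness of [U] connects the graph of occupied cells. A path without repetition is thus of
    bounded length, and each edge costs two passages between meeting balls, [5 * h] each. *)
Lemma chain_bound (R : realType) (d : nat) (h D : R) : 0 < h -> 0 < D ->
  exists2 K : R, 0 < K & forall (U : set 'rV[R]_d) (s : R),
    connected U -> U = thick U h -> (forall x y, U x -> U y -> enorm (x - y) <= D) ->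
    0 < s <= h / 4 -> forall z z', core U h s z -> core U h s z' ->
    exists2 n, reach (core U h s) (2 * s) n z z' & n%:R * s <= K.
Proof.
move=> h0 D0; pose B := D + 1; have B0 : 0 < B by rewrite /B; lra.
pose k := Num.truncn (d%:R * (2 * B) / h).
have kh : d%:R * (2 * B / k.+1%:R) < h.
  have := truncnS_gt (d%:R * (2 * B) / h); rewrite -/k ltr_pdivrMr// => hk.
  by rewrite mulrA ltr_pdivrMr ?ltr0n// (mulrC h).
have [c hc] := @exists_cells R d k B B0.
pose T : finType := {ffun 'I_d -> 'I_k.+1}.
pose K := #|T|%:R * (10 * h) + 5 * h.
have K0 : 0 <= K by rewrite addr_ge0 ?mulr_ge0//; lra.
exists (K + 4 * h) => [|U s conn UE UD /andP[s0 sh] z z' Zz Zz']; first lra.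
have cU y : centers U h y -> U y.
  by move=> yU; apply: yU; rewrite /eball /= subrr enorm0.
have [y0 y0U y0z] : exists2 y, centers U h y & enorm (z - y) <= h - s by [].
pose C y := c (y - y0).
have hC y y' : centers U h y -> centers U h y' -> C y = C y' -> meet h y y'.
  move=> yU y'U cyy; exists y'; last by rewrite /eball /= subrr enorm0.
  have b w : centers U h w -> enorm (w - y0) < B.
    by move=> wU; have := UD _ _ (cU _ wU) (cU _ y0U); rewrite /B; lra.
  have := hc _ _ (b _ yU) (b _ y'U) cyy; rewrite opprB addrA subrK /eball /= enorm_distC => /le_lt_trans; exact.
pose e : rel T := fun a b => `[< exists y y', [/\ centers U h y, centers U h y', a = C y,
  b = C y' & meet h y y'] >].
have link y : centers U h y -> connect e (C y0) (C y).
  pose good y := centers U h y /\ connect e (C y0) (C y).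
  pose bad y := centers U h y /\ ~ connect e (C y0) (C y).
  have open_union (P : set 'rV[R]_d) : open [set p | exists2 y, P y & eball y h p].
    rewrite (_ : [set p | _] = \bigcup_(y in P) eball y h) //.
    by apply: bigcup_open => w _; exact: open_eball.
  have cov p : U p -> exists2 y, centers U h y & eball y h p.
    by rewrite {1}UE => -[_ [w [_ wp wU]]]; exists w.
  have sep p : ~ ((exists2 y, good y & eball y h p) /\ (exists2 y, bad y & eball y h p)).
    move=> [[w [wU wg] wp] [v [vU vb] vp]]; apply: vb.
    apply: (connect_trans wg); apply: connect1; apply/asboolP.
    by exists w, v; split => //; exists p.
  (* Good balls and bad balls cover [U] and never meet, so the good part is open and closed in [U],
     hence all of [U]. *)
  pose G := U `&` [set p | exists2 y, good y & eball y h p].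
  have GU : G = U.
    apply: conn.
    - exists y0; split; first exact: cU.
      by exists y0; [split|rewrite /eball /= subrr enorm0].
    - by exists [set p | exists2 y, good y & eball y h p].
    exists (~` [set p | exists2 y, bad y & eball y h p]); first exact/open_closedC/open_union.
    apply/seteqP; split => p [Up hp]; split => //.
      by move=> hb; exact: (sep p).
    have [w wU wp] := cov _ Up; exists w => //; split => //.
    by apply: contrapT => hw; apply: hp; exists w.
  move=> yU; have : G y by rewrite GU; exact: cU.
  move=> [_ [w [wU wg] wy]]; apply: (connect_trans wg); apply: connect1; apply/asboolP.
  by exists w, y; split => //; exists y => //; rewrite /eball /= subrr enorm0.
have along (q : seq T) : forall y y', centers U h y -> centers U h y' -> path e (C y) q ->
    C y' = last (C y) q ->
    exists2 n, reach (core U h s) (2 * s) n y y' & n%:R * s <= (size q)%:R * (10 * h) + 5 * h.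
  elim: q => [|b q IH] y y' yU y'U /=.
    move=> _ cyy; have [n nr nh] := reach_meet h0 s0 sh yU y'U (hC _ _ yU y'U (esym cyy)).
    by exists n => //; rewrite mul0r add0r.
  move=> /andP[/asboolP[y1 [y2 [y1U y2U c1 c2 m12]]] pq] cl.
  have [n1 r1 h1] := reach_meet h0 s0 sh yU y1U (hC _ _ yU y1U c1).
  have [n2 r2 h2] := reach_meet h0 s0 sh y1U y2U m12.
  rewrite c2 in pq cl; have [n3 r3 h3] := IH _ _ y2U y'U pq cl.
  exists (n1 + (n2 + n3))%N; first exact: reach_cat r1 (reach_cat r2 r3).
  by rewrite !natrD !mulrDl -natr1; lra.
have from0 y : centers U h y -> exists2 n, reach (core U h s) (2 * s) n y0 y & n%:R * s <= K.
  move=> yU; have /connectP[q pq lq] := link _ yU.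
  case/shortenP: pq lq => q' pq' uq' _ lq'.
  have [n nr nh] := along _ _ _ y0U yU pq' lq'; exists n => //; apply: le_trans nh _.
  rewrite lerD2r ler_wpM2r//; first lra.
  rewrite ler_nat; have := max_card [in C y0 :: q']; rewrite (card_uniqP uq') /=.
  exact: ltnW.
have [y' y'U y'z] : exists2 y, centers U h y & enorm (z' - y) <= h - s by [].
have [n1 r1 h1] := reach_center h0 s0 sh y0U y0z.
have [n2 r2 h2] := reach_center h0 s0 sh y'U y'z.
have [n r3 h3] := from0 _ y'U.
exists (n1 + (n + n2))%N; last by rewrite !natrD !mulrDl; lra.
apply: reach_cat (reach_cat r3 r2); apply: reach_sym r1; exact: centers_core.
Qed.

(** * From local similarities to a global one *)

Section AffineSimilarity.
Context {R : realType} {d : nat}.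
Implicit Types (b p q : 'rV[R]_d) (l : R) (O : 'M[R]_d).

Definition affine_sim b l O p := b + l *: (p *m O).

Lemma affine_simE b l O p : affine_sim b l O p = b + p *m (l *: O).
Proof. by rewrite /affine_sim scalemxAr. Qed.

Lemma affine_sim_dist b l O p q : 0 <= l -> O *m O^T = 1%:M ->
  enorm (affine_sim b l O p - affine_sim b l O q) = l * enorm (p - q).
Proof.
move=> l0 OO; rewrite /affine_sim opprD addrACA subrr add0r -scalerBr -mulmxBl.
by rewrite enormZ ger0_norm// orthonormal_enorm.
Qed.

End AffineSimilarity.

(* [phi] is compared with the local similarity around the ball whose image is largest, up to
   a factor 2: its ratio [l] is then bounded below by the scale of every local image, and
   above by [q / h]. *)
Lemma single_embedding_small (R : realType) (d : nat) (k : 'I_d) (h D q : R) :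
  0 < h -> 0 < D -> 0 <= q ->
  exists C c : R, [/\ 0 < C, 0 < c & forall (U A : set 'rV[R]_d) phi r s eps,
    connected U -> U = thick U h -> U !=set0 ->
    (forall x y, U x -> U y -> enorm (x - y) <= D) ->
    A `<=` U -> (forall x y, A x -> A y -> enorm (phi x - phi y) <= q) ->
    0 < s -> s <= h / 4 -> s <= r / 4 -> r <= D ->
    0 < eps <= c * s ^+ 2 ->
    (forall y, U y -> exists2 p, A p & enorm (y - p) < eps) ->
    (forall p, A p -> isotonic phi (A `&` eball p r)) ->
    exists2 S : 'rV[R]_d -> 'rV[R]_d, similarity S &
      forall p, A p -> enorm (phi p - S p) <= C * eps / s ^+ 2].
Proof.
move=> h0 D0 q0; have d0 : (0 < d)%N by apply: leq_ltn_trans (ltn_ord k).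
have dR : 1 <= d%:R :> R by rewrite ler1n.
have [C1 [e1 [C10 e10 HL]]] := local_affine R k.
have [K K0 HK] := chain_bound d h0 D0.
(* [C2] collects the chain: at most [K / s] links, each extrapolating the error [2 * tau] from
   radius [s / 8] to [D]. The other term of [C3] is the local error at the start of the chain, with
   [s <= h]. *)
pose C2 := 16 * K * (1 + 16 * d%:R) * D * C1; pose C3 := C2 + C1 * h ^+ 2.
have C20 : 0 < C2 by rewrite !mulr_gt0//; lra.
have C30 : 0 < C3 by rewrite addr_gt0// mulr_gt0// exprn_gt0.
(* The three bounds serve [local_affine], [affine_compare] at radius [s / 8], and [tau <= x / 4].
   The first bound in [c] turns [eps <= c * s ^ 2] into [eps <= m * s]; the second makes the global
   error at most [l * h / 8]. *)
pose m := Num.min e1 (Num.min (64 * d%:R)^-1 (8 * C1)^-1).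
have m0 : 0 < m by rewrite !lt_min e10 !invr_gt0 !mulr_gt0//; lra.
pose c := Num.min (4 * m / h) (h / (64 * C3)).
have c0 : 0 < c by rewrite lt_min !divr_gt0// mulr_gt0.
have ch : c * h / 4 <= m.
  have h1 : c <= 4 * m / h by rewrite ge_min lexx.
  by have := ler_wpM2r (ltW h0) h1; rewrite divfK ?gt_eqF//; lra.
have cC3 : c * (64 * C3) <= h.
  have h1 : c <= h / (64 * C3) by rewrite ge_min lexx orbT.
  by rewrite -ler_pdivlMr// mulr_gt0.
have C3E : C3 = C2 + C1 * h ^+ 2 by [].
have C2E : C2 = 16 * K * (1 + 16 * d%:R) * D * C1 by [].
have me1 : m <= e1 by rewrite ge_min lexx.
have md : m <= (64 * d%:R)^-1 by rewrite !ge_min lexx orbT.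
have mC : m <= (8 * C1)^-1 by rewrite !ge_min lexx !orbT.
clearbody C3 C2 c m.
exists (32 * C3 * q / h + 1), c; split => //.
  by rewrite ltr_wpDl// divr_ge0 ?(ltW h0)// !mulr_ge0// ltW.
move=> U A phi r s eps conn UE [u0 Uu0] UD AU phiq s0 sh sr rD /andP[eps0 epsc] dense iso.
have s20 : 0 < s ^+ 2 by rewrite exprn_gt0.
have epsm : eps <= m * s.
  have h1 : c * s <= c * (h / 4) by rewrite ler_pM2l.
  have h2 : c * s <= m by lra.
  by have := ler_wpM2r (ltW s0) h2; lra.
have eps1 : eps <= e1 * s.
  by apply: le_trans epsm _; rewrite ler_pM2r.
have eps64 : eps * (64 * d%:R) <= s.
  have : eps <= (64 * d%:R)^-1 * s.
    by apply: le_trans epsm _; rewrite ler_pM2r.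
  by rewrite mulrC ler_pdivlMr ?mulr_gt0//; lra.
have epsC1 : C1 * (eps / s) <= 1/8.
  have : eps <= (8 * C1)^-1 * s.
    by apply: le_trans epsm _; rewrite ler_pM2r.
  rewrite mulrC ler_pdivlMr ?mulr_gt0// => h1.
  by rewrite mulrA ler_pdivrMr//; lra.
have eps_s : eps <= s / 64 by have := ler_wpM2l (ltW eps0) dR; lra.
pose Z := core U h s.
have denseZ z y : Z z -> eball z s y -> exists2 p, A p & enorm (y - p) < eps.
  by move=> Zz zy; apply: dense; exact: (eball_core h0 s0 sh Zz zy).
have ZU z : Z z -> U z.
  by move=> Zz; apply: (eball_core h0 s0 sh Zz); rewrite /eball /= subrr enorm0.
have cov p : U p -> exists2 z, Z z & enorm (p - z) < s.
  rewrite {1}UE => -[_ [y [_ py yU]]].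
  by have [z [_ Zz pz]] := core_near h0 s0 sh yU py; exists z.
have isoZ z : Z z -> isotonic phi (A `&` eball z (2 * s)).
  move=> Zz; have [p Ap zp] := dense _ (ZU _ Zz).
  have sub y : (A `&` eball z (2 * s)) y -> (A `&` eball p r) y.
    move=> [Ay]; rewrite /eball /= => yz; split => //; rewrite /eball /=.
    by have := enorm_triangle z y p; clear -yz zp eps_s sr s0; lra.
  by move=> x y x' y' /sub hx /sub hy /sub hx' /sub hy'; exact: iso Ap _ _ _ _ hx hy hx' hy'.
pose E := [set t | exists z p q, [/\ Z z, A p /\ A q, eball z s p, eball z s q &
  t = enorm (phi p - phi q)]].
have [w Zw _] := cov _ Uu0.
have [v Av wv] := dense _ (ZU _ Zw).
have [||x [z0 [p1 [q1 [Zz0 [Ap1 Aq1] zp1 zq1 xE]]]] xmax] := @near_max _ E q.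
- exists (enorm (phi v - phi v)), w, v, v.
  have wv' : eball w s v by rewrite /eball /= enorm_distC; clear -wv eps_s s0; lra.
  by split.
- by move=> _ [z [p [p' [_ [Ap Ap'] _ _ ->]]]]; rewrite enorm_ge0 phiq.
pose tau := C1 * (eps / s) * (2 * x).
have x0 : 0 <= x by rewrite xE enorm_ge0.
have es0 : 0 <= eps / s by rewrite divr_ge0 ?ltW.
have tau0 : 0 <= tau by rewrite !mulr_ge0 ?invr_ge0// ?ltW.
have tauE : tau = C1 * (eps / s) * (2 * x) by [].
clearbody tau.
have /choice[W HW] z : exists t : 'rV[R]_d * R * 'M[R]_d, Z z ->
    [/\ 0 <= t.1.2, t.2 *m t.2^T = 1%:M & forall p, A p -> enorm (p - z) <= 5/4 * s ->
      enorm (phi p - affine_sim t.1.1 t.1.2 t.2 p) <= tau].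
  have [Zz|nZz] := pselect (Z z); last by exists (0, 0, 0) => /nZz.
  have [|||||b [l [ O [l0 OO hl]]]] := HL A phi z s eps (2 * x).
  - by [].
  - by rewrite eps0.
  - by move=> y; exact: denseZ.
  - exact: isoZ.
  - by move=> p p' Ap Ap' hp hp'; apply: xmax; exists z, p, p'.
  by exists (b, l, O) => _; rewrite tauE; split.
pose V z := affine_sim (W z).1.1 (W z).1.2 (W z).2.
pose kappa := (1 + 16 * d%:R) * (D / (s / 8)) * (2 * tau).
have step p z z' : U p -> Z z -> Z z' -> enorm (z - z') < 2 * s ->
    enorm (V z p - V z' p) <= kappa.
  move=> Up Zz Zz' zz'; pose y := z + (7/16) *: (z' - z).
  have yz : enorm (y - z) <= 7/8 * s.
    by rewrite /y addrC addKr enormZ ger0_norm ?(enorm_distC z' z); clear -zz'; lra.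
  have yz' : enorm (y - z') <= 9/8 * s.
    have -> : y - z' = (9/16) *: (z - z') by apply/rowP => i; rewrite /y !mxE; field.
    by rewrite enormZ ger0_norm; clear -zz'; lra.
  (* The lens of the balls of radius [5/4 s] around [z] and [z'] need not lie in [U]; moving
     its center towards [z] yields a ball on which [A] is dense. *)
  have near a : eball y (s / 8) a -> enorm (a - z) < s /\ enorm (a - z') < 5/4 * s.
    rewrite /eball /= => ay; have := enorm_triangle y a z; have := enorm_triangle y a z'.
    by clear -yz yz' ay s0; split; lra.
  have Uy : U y by apply: (eball_core h0 s0 sh Zz); rewrite /eball /=; clear -yz s0; lra.
  rewrite /V !affine_simE; apply: (@affine_compare _ _ A y _ _ _ _ (s / 8) eps) => //.
  - by clear -s0; lra.
  - by clear -eps64; lra.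
  - by move=> a /near[az _]; exact: (denseZ z).
  - move=> a Aa /near[az az']; rewrite -!affine_simE.
    have [_ _ h1] := HW z Zz; have [_ _ h2] := HW z' Zz'.
    have {}h1 := h1 a Aa ltac:(clear -az s0; lra); have {}h2 := h2 a Aa (ltW az').
    have := enorm_triangle (phi a) (V z a) (V z' a); rewrite (enorm_distC _ (phi a)).
    by clear -h1 h2; rewrite /V; lra.
  - by clear -sr rD s0; lra.
  - exact: UD.
have [l0 O0 close0] := HW z0 Zz0.
have V0 : V z0 = affine_sim (W z0).1.1 (W z0).1.2 (W z0).2 by [].
move: V0 l0 O0 close0; set b := (W z0).1.1; set l := (W z0).1.2; set O := (W z0).2.
move=> V0 l0 O0 close0.
have e20 : 0 < eps / s ^+ 2 by exact: divr_gt0.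
have xs0 : 0 <= 2 * x / s by rewrite divr_ge0 ?(ltW s0)// mulr_ge0.
(* [xs] is the largest local stretch, up to a constant, and [e2] the target rate; every error below
   is a multiple of [xs * e2]. *)
set xs := 2 * x / s in xs0; set e2 := eps / s ^+ 2 in e20.
have kappaE n : n%:R * kappa = (n%:R * s) * (16 * (1 + 16 * d%:R) * D * C1 * xs * e2).
  by rewrite /kappa tauE /xs /e2; field; rewrite gt_eqF.
have tauE2 : tau = s ^+ 2 * (C1 * xs * e2).
  by rewrite tauE /xs /e2; field; rewrite gt_eqF.
have xsE : xs = 2 * x / s by [].
have e2E : e2 = eps / s ^+ 2 by [].
clearbody kappa xs e2.
pose Err := C3 * xs * e2.
have err p : A p -> enorm (phi p - V z0 p) <= Err.
  move=> Ap; have Up := AU _ Ap; have [z Zz pz] := cov _ Up.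
  have [_ _ h1] := HW z Zz; have {}h1 := h1 p Ap ltac:(clear -pz s0; lra).
  have s0h : 0 < s <= h / 4 by rewrite s0.
  have [n nr nK] := HK U s conn UE UD s0h z z0 Zz Zz0.
  have h2 := reach_dist (fun z z' => step p z z' Up) Zz nr.
  have h3 : n%:R * kappa <= C2 * xs * e2.
    have -> : C2 * xs * e2 = K * (16 * (1 + 16 * d%:R) * D * C1 * xs * e2) by rewrite C2E; ring.
    have d16 : 0 <= 1 + 16 * d%:R :> R by clear -dR; lra.
    by rewrite kappaE ler_wpM2r// !mulr_ge0// ltW.
  have h4 : tau <= C1 * h ^+ 2 * xs * e2.
    have -> : C1 * h ^+ 2 * xs * e2 = h ^+ 2 * (C1 * xs * e2) by ring.
    rewrite tauE2.
    rewrite ler_wpM2r//; first by rewrite !mulr_ge0// ltW.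
    by rewrite ler_pXn2r// ?nnegrE; clear -s0 h0 sh; lra.
  have h5 := enorm_triangle (V z p) (phi p) (V z0 p).
  rewrite (_ : Err = C2 * xs * e2 + C1 * h ^+ 2 * xs * e2); last by rewrite /Err C3E; ring.
  by clear -h1 h2 h3 h4 h5; rewrite -/(V z) in h1; lra.
have zp (z p : 'rV[R]_d) : eball z s p -> enorm (p - z) <= 5/4 * s.
  by rewrite /eball /=; clear -s0; lra.
(* The pair realising [x] is at most [2 * s] apart, so [x <= 2 * s * l + 2 * tau], and
   [tau <= x / 4] is absorbed. *)
have xl : xs <= 8 * l.
  rewrite xsE ler_pdivrMr//.
  have h1 := close0 p1 Ap1 (zp _ _ zp1); have h2 := close0 q1 Aq1 (zp _ _ zq1).
  have h3 := affine_sim_dist b p1 q1 l0 O0.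
  have h4 : l * enorm (p1 - q1) <= l * (2 * s).
    rewrite ler_wpM2l//; have := enorm_triangle z0 p1 q1; rewrite (enorm_distC z0).
    by move: zp1 zq1; rewrite /eball /=; clear; lra.
  have h5 : tau <= 1/8 * (2 * x) by rewrite tauE ler_wpM2r// mulr_ge0.
  have h6 := enorm_triangle (affine_sim b l O p1) (phi p1) (phi q1).
  have h7 := enorm_triangle (affine_sim b l O q1) (affine_sim b l O p1) (phi q1).
  rewrite (enorm_distC (affine_sim b l O q1) (phi q1)) in h7; rewrite -xE in h6.
  by clear -h1 h2 h3 h4 h5 h6 h7; lra.
have e2c : e2 <= c by rewrite e2E ler_pdivrMr.
have Errl : Err <= 8 * C3 * l * e2.
  have h1 := ler_wpM2l (ltW C30) xl.
  by rewrite ler_wpM2r ?(ltW e20)//; clear -h1; lra.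
(* Two points of [A] near the ends of a segment of length [h] in [U] give
   [l * (h / 2) <= q + 2 * Err], where [Err <= l * h / 8]. *)
have lq : l <= 4 * q / h.
  have Errh : Err <= l * h / 8.
    apply: le_trans Errl _; have lC : 0 <= 8 * C3 * l by rewrite !mulr_ge0// ltW.
    have h1 := ler_wpM2l lC e2c; have h2 := ler_wpM2l l0 cC3.
    by clear -h1 h2; lra.
  have [y yU] : exists y, eball y h `<=` U.
    by move: Uu0; rewrite {1}UE => -[_ [y [Uy _ yU]]]; exists y.
  have Ua t : `|t| < h -> U (y + axis k t).
    by move=> th; apply: yU; rewrite /eball /= addrC addKr enorm_axis.
  have [|a Aa ha] := dense (y + axis k (h / 2)).
    by apply: Ua; rewrite ger0_norm; clear -h0; lra.
  have [|a' Aa' ha'] := dense (y + axis k (- (h / 2))).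
    by apply: Ua; rewrite normrN ger0_norm; clear -h0; lra.
  have hd : h <= enorm (y + axis k (h / 2) - (y + axis k (- (h / 2)))).
    by rewrite opprD addrACA subrr add0r enorm_axisB ger0_norm; clear -h0; lra.
  have aa := near_dist_gt ha ha' hd.
  have h7 := affine_sim_dist b a a' l0 O0.
  have h1 := err _ Aa; have h2 := err _ Aa'; have h3 := phiq _ _ Aa Aa'.
  have h4 : l * (h / 2) <= l * enorm (a - a').
    by rewrite ler_wpM2l//; clear -aa eps_s sh h0; lra.
  have h5 := enorm_triangle (phi a) (V z0 a) (V z0 a').
  have h6 := enorm_triangle (phi a') (phi a) (V z0 a').
  rewrite (enorm_distC (V z0 a) (phi a)) in h5; rewrite -V0 in h7.
  by rewrite ler_pdivlMr//; clear -h1 h2 h3 h4 h5 h6 h7 Errh; lra.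
(* The ratio [l] may vanish. Increasing it by [mu], with the image of [u0] kept fixed, makes it
   positive and moves points by at most [e2] on [U]. *)
pose mu := e2 / D; have mu0 : 0 < mu by exact: divr_gt0.
exists (affine_sim (b - mu *: (u0 *m O)) (l + mu) O).
  exists (l + mu) => [|p p']; first by rewrite ltr_wpDl.
  by apply: affine_sim_dist => //; rewrite addr_ge0// ltW.
move=> p Ap; apply: le_trans (enorm_triangle (V z0 p) _ _) _.
have -> : V z0 p - affine_sim (b - mu *: (u0 *m O)) (l + mu) O p = mu *: ((u0 - p) *m O).
  rewrite V0 /affine_sim mulmxBl; set X := p *m O; set Y := u0 *m O.
  by apply/rowP => i; rewrite !mxE; ring.
rewrite enormZ gtr0_norm// orthonormal_enorm//.
have h1 : mu * enorm (u0 - p) <= e2.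
  have := ler_wpM2l (ltW mu0) (UD _ _ Uu0 (AU _ Ap)).
  by rewrite {2}/mu divfK// gt_eqF.
have C3e : 0 <= 8 * C3 * e2 by rewrite !mulr_ge0// ltW.
have h2 := ler_wpM2l C3e lq; have h3 := err _ Ap.
have -> : (32 * C3 * q / h + 1) * eps / s ^+ 2 = 8 * C3 * e2 * (4 * q / h) + e2.
  by rewrite e2E; field; rewrite !gt_eqF.
by apply: lerD h1; apply: le_trans h3 _; apply: le_trans Errl _; clear -h2; lra.
Qed.

(** Taking [s = m * r] meets both [s <= r / 4] and [s <= h / 4], since [r <= D]. If
    [eps > c * s ^ 2], the similarity of ratio [1 / D] through one image point is within [q + 1] of
    [phi], which is at most [(q + 1) / c * (eps / s ^ 2)]. *)
Lemma single_embedding (R : realType) (d : nat) (k : 'I_d) (h D q : R) :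
  0 < h -> 0 < D -> 0 <= q ->
  exists2 C : R, 0 < C & forall (U A : set 'rV[R]_d) phi r eps,
    connected U -> U = thick U h -> U !=set0 ->
    (forall x y, U x -> U y -> enorm (x - y) <= D) ->
    A `<=` U -> (forall x y, A x -> A y -> enorm (phi x - phi y) <= q) ->
    0 < r <= D -> 0 < eps ->
    (forall y, U y -> exists2 p, A p & enorm (y - p) < eps) ->
    (forall p, A p -> isotonic phi (A `&` eball p r)) ->
    exists2 S : 'rV[R]_d -> 'rV[R]_d, similarity S &
      forall p, A p -> enorm (phi p - S p) <= C * eps / r ^+ 2.
Proof.
move=> h0 D0 q0; have [C [c [C0 c0 HS]]] := single_embedding_small k h0 D0 q0.
pose m := Num.min 1 (h / D) / 4.
have m0 : 0 < m by rewrite divr_gt0// lt_min ltr01 divr_gt0.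
have m1 : m <= 1 / 4 by rewrite ler_pM2r// ge_min lexx.
have mD : m * D <= h / 4.
  have : m <= h / D / 4 by rewrite ler_pM2r// ge_min lexx orbT.
  move=> /(ler_wpM2r (ltW D0)) /le_trans; apply.
  by rewrite (mulrAC _ 4^-1) divfK ?gt_eqF.
clearbody m.
pose B := C + (q + 1) / c.
have qc0 : 0 <= (q + 1) / c by rewrite divr_ge0 ?(ltW c0)//; clear -q0; lra.
have B0 : 0 < B by rewrite /B; clear -C0 qc0; lra.
exists (B / m ^+ 2); first by rewrite divr_gt0// exprn_gt0.
move=> U A phi r eps conn UE U0 UD AU phiq /andP[r0 rD] eps0 dense iso.
pose s := m * r; have s0 : 0 < s by exact: mulr_gt0.
have s20 : 0 < s ^+ 2 by rewrite exprn_gt0.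
have e20 : 0 <= eps / s ^+ 2 by rewrite ltW// divr_gt0.
have sr : s <= r / 4 by have := ler_wpM2r (ltW r0) m1; rewrite /s; clear; lra.
have sh : s <= h / 4.
  by apply: le_trans mD; rewrite ler_pM2l.
suff [S sS hS] : exists2 S : 'rV[R]_d -> 'rV[R]_d, similarity S &
    forall p, A p -> enorm (phi p - S p) <= B * (eps / s ^+ 2).
  exists S => // p /hS; congr (_ <= _); rewrite /s.
  by field; rewrite !gt_eqF.
have [es|es] := leP eps (c * s ^+ 2).
  have ce : 0 < eps <= c * s ^+ 2 by rewrite eps0.
  have [S sS hS] := HS U A phi r s eps conn UE U0 UD AU phiq s0 sh sr rD ce dense iso.
  exists S => // p /hS /le_trans; apply; rewrite -mulrA ler_wpM2r//.
  by rewrite /B; clear -qc0; lra.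
have [u Uu] := U0; have [a Aa _] := dense _ Uu.
have DV : 0 < D^-1 by rewrite invr_gt0.
exists (affine_sim (phi a - D^-1 *: (a *m 1%:M)) D^-1 1%:M).
  exists D^-1 => // p p'; apply: affine_sim_dist; [exact: ltW|by rewrite trmx1 mulmx1].
move=> p Ap; have c1 : c <= eps / s ^+ 2 by rewrite ler_pdivlMr// ltW.
have h1 : (q + 1) / c * c <= (q + 1) / c * (eps / s ^+ 2) by rewrite ler_wpM2l.
rewrite divfK ?gt_eqF// in h1.
have h2 : 0 <= C * (eps / s ^+ 2) by rewrite mulr_ge0// ltW.
apply: (@le_trans _ _ (q + 1)); last by rewrite /B mulrDl; clear -h1 h2; lra.
have -> : phi p - affine_sim (phi a - D^-1 *: (a *m 1%:M)) D^-1 1%:M p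
    = (phi p - phi a) - D^-1 *: (p - a).
  by rewrite /affine_sim !mulmx1; apply/rowP => i; rewrite !mxE; ring.
apply: le_trans (enormB_le _ _) _; apply: lerD; first exact: phiq.
rewrite enormZ (gtr0_norm DV) mulrC ler_pdivrMr// mul1r.
exact: UD (AU _ Ap) (AU _ Aa).
Qed.

(** * Diameter, density radius and conclusion *)

Section DiamDeltaH.
Context {R : realType} {d : nat}.
Implicit Types (L V : set 'rV[R]_d) (p x y : 'rV[R]_d).

Lemma bounded_set_enorm V : bounded_set V -> exists M : R, forall x, V x -> enorm x <= M.
Proof.
move=> [M [_ hM]]; exists (d%:R * (M + 2)) => x Vx.
have xM : `|x| <= M + 1 by apply: hM => //; rewrite ltrDl.
have : ball (0 : 'rV[R]_d) (M + 2) x.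
  by rewrite mx_norm_ball /ball_ /= sub0r normrN; lra.
move=> [_ h]; apply: enorm_le_coord => i; have := h ord0 i.
by rewrite /ball /= mxE sub0r normrN => /ltW.
Qed.

Lemma enorm_le_diam V x y : bounded_set V -> V x -> V y -> enorm (x - y) <= diam V.
Proof.
move=> /bounded_set_enorm[M hM] Vx Vy; apply: ub_le_sup; last by exists x => //; exists y.
exists (M + M) => _ [p Vp [p' Vp' <-]]; apply: le_trans (enormB_le _ _) _.
by apply: lerD; exact: hM.
Qed.

Lemma delta_H_near L V y (c D : R) : L !=set0 -> V y ->
  (forall y p, V y -> L p -> enorm (y - p) <= D) ->
  delta_H L V < c -> exists2 p, L p & enorm (y - p) < c.
Proof.
move=> [p0 Lp0] Vy LD dc.
have low z : has_lbound [set enorm (z - x) | x in L].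
  by exists 0 => _ [x _ <-]; exact: enorm_ge0.
have : inf [set enorm (y - x) | x in L] < c.
  apply: le_lt_trans dc; apply: ub_le_sup; last by exists y.
  exists D => _ [z Vz <-]; apply: (@le_trans _ _ (enorm (z - p0))); last exact: LD.
  by apply: ge_inf => //; exists p0.
move=> /inf_lt[]; first by exists (enorm (y - p0)), p0.
by move=> _ [p Lp <-] h; exists p.
Qed.

(* Pigeonhole on [n + 2] equally spaced points of a ball in [V]. *)
Lemma delta_H_Omega_gt0 (k : 'I_d) (x : nat -> 'rV[R]_d) n V (z : 'rV[R]_d) (h D : R) :
  (1 <= n)%N -> 0 < h -> eball z h `<=` V ->
  (forall y p, V y -> Omega x n p -> enorm (y - p) <= D) -> 0 < delta_H (Omega x n) V.
Proof.
move=> n1 h0 zV LD; rewrite ltNge; apply/negP => d0.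
have L0 : Omega x n !=set0 by exists (x 1%N); exists 1%N.
pose a := h / n.+2%:R; have a0 : 0 < a by rewrite divr_gt0.
pose y (j : 'I_n.+2) := z + axis k (j%:R * a).
have Vy j : V (y j).
  apply: zV; rewrite /eball /= /y addrC addKr enorm_axis.
  rewrite ger0_norm; last by apply: mulr_ge0 => //; exact: ltW.
  by rewrite /a mulrA ltr_pdivrMr// mulrC ltr_pM2l// ltr_nat.
have /choice[f hf] j : exists i : 'I_n.+1, enorm (y j - x i) < a / 2.
  have [|_ [i /= /andP[_ i_n] <-] hi] := @delta_H_near _ _ (y j) (a / 2) D L0 (Vy j) LD.
    by lra.
  by exists (Ordinal (i_n : (i < n.+1)%N)).
have : ~~ injectiveb f by apply/injectiveP => /leq_card; rewrite !card_ord ltnn.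
move=> /injectivePn[i [j ij fij]].
have hi := hf i; have hj := hf j; rewrite -fij in hj.
have := enorm_triangle (x (f i)) (y i) (y j); rewrite (enorm_distC (x (f i)) (y j)).
have -> : y i - y j = axis k ((i%:R - j%:R) * a).
  by rewrite /y opprD addrACA subrr add0r axisB mulrBl.
rewrite enorm_axis normrM (gtr0_norm a0).
have : 1 <= `|i%:R - j%:R : R|.
  move: ij; rewrite -val_eqE neq_ltn => /orP[] lt.
    by rewrite distrC ger0_norm ?subr_ge0 ?ler_nat 1?ltnW// lerBrDl natr1 ler_nat.
  by rewrite ger0_norm ?subr_ge0 ?ler_nat 1?ltnW// lerBrDl natr1 ler_nat.
move=> /(ler_wpM2r (ltW a0)); rewrite mul1r; lra.
Qed.

End DiamDeltaH.

Lemma diam_dim0 (R : realType) (V : set 'rV[R]_0) : diam V <= 0.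
Proof.
have [V0|/set0P[x Vx]] := eqVneq V set0.
  rewrite /diam (_ : [set _ | _ in _ & _ in _] = set0) ?sup0//.
  by rewrite V0; apply/seteqP; split => // _ [x []].
apply: ge_sup; first by exists (enorm (x - x)), x => //; exists x.
by move=> _ [y _ [z _ <-]]; rewrite thinmx0 enorm0.
Qed.
Theorem theorem4 (R : realType) (d : nat) (h rhoU diamU diamQ : R) (h_gt0 : 0 < h) :
  exists2 C : R, 0 < C &
  forall (U Q : set 'rV[R]_d) (x : nat -> 'rV[R]_d)
         (phi : nat -> 'rV[R]_d -> 'rV[R]_d) (r : nat -> R),
    bounded_set U -> connected U -> open U -> U = thick U h ->
    bounded_set Q ->
    rho U = rhoU -> diam U = diamU -> diam Q = diamQ ->
    (forall n, (1 <= n)%N -> U (x n)) ->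
    U `<=` closure [set x n | n in [set n | (1 <= n)%N]] ->
    (forall n, (1 <= n)%N -> forall p, Omega x n p -> Q (phi n p)) ->
    (forall n, (1 <= n)%N -> 0 < r n <= diam U) ->
    (forall n, (1 <= n)%N -> forall p, Omega x n p ->
       isotonic (phi n) (Omega x n `&` eball p (r n))) ->
    (forall n, (1 <= n)%N -> forall p p' q q',
       Omega x n p -> Omega x n p' -> Omega x n q -> Omega x n q' ->
       enorm (p - p') < r n -> r n <= enorm (q - q') ->
       enorm (phi n p - phi n p') <= enorm (phi n q - phi n q')) ->
    exists S : nat -> 'rV[R]_d -> 'rV[R]_d,
      forall n, (1 <= n)%N ->
        similarity (S n) /\
        forall p, Omega x n p ->
          enorm (phi n p - S n p) <= C * delta_H (Omega x n) U / r n ^+ 2.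

Proof.
(* In dimension 0, or if [diamU <= 0], no radius satisfies [0 < r 1 <= diam U], and any constant
   will do. *)
case: d => [|d].
  exists 1 => // U Q x phi r _ _ _ _ _ _ _ _ _ _ _ hr.
  by have := hr 1%N isT; have := diam_dim0 U; lra.
have [D0|D0] := leP diamU 0.
  exists 1 => // U Q x phi r _ _ _ _ _ _ UD _ _ _ _ hr.
  by have := hr 1%N isT; rewrite UD; lra.
(* The absolute value supplies a nonnegative bound before any [Q] of diameter [diamQ] is given. *)
have [C C0 HC] := single_embedding (@ord0 d) h_gt0 D0 (normr_ge0 diamQ).
(* Density at scale [eps] asks for strict inequality, so [eps] is twice [delta_H]; this exceeds
   [delta_H] because a finite set never fills [U]. *)
exists (C * 2); first by rewrite mulr_gt0.
move=> U Q x phi r Ub conn Uo UE Qb _ UD QD xU _ phiQ hr iso _.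
have UD' y y' : U y -> U y' -> enorm (y - y') <= diamU.
  by rewrite -UD; exact: enorm_le_diam.
have OU n : Omega x n `<=` U by move=> _ [i /= /andP[i1 _] <-]; exact: xU.
have U1 : U (x 1%N) by exact: xU.
have [z zU] : exists z, eball z h `<=` U.
  by move: U1; rewrite {1}UE => -[_ [z [_ _ zU]]]; exists z.
suff /choice[S hS] n : exists S : 'rV[R]_d.+1 -> 'rV[R]_d.+1, (1 <= n)%N ->
    similarity S /\ forall p, Omega x n p ->
      enorm (phi n p - S p) <= C * 2 * delta_H (Omega x n) U / r n ^+ 2 by exists S.
have [n1|n0] := leqP 1 n; last by exists id.
have LD y p : U y -> Omega x n p -> enorm (y - p) <= diamU.
  by move=> Uy /OU; exact: UD'.
have dl := delta_H_Omega_gt0 ord0 n1 h_gt0 zU LD.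
have [|||||||S sS hS] := HC U (Omega x n) (phi n) (r n) (2 * delta_H (Omega x n) U) conn UE _ UD'.
- by exists (x 1%N).
- exact: OU.
- move=> p p' /(phiQ _ n1) Qp /(phiQ _ n1) Qp'; apply: le_trans (ler_norm _).
  by rewrite -QD; exact: enorm_le_diam.
- by rewrite -UD; exact: hr.
- by rewrite mulr_gt0.
- move=> y Uy; apply: (delta_H_near _ Uy LD); last by lra.
  by exists (x 1%N), 1%N.
- by move=> p Op; exact: iso.
by exists S => _; split => // p /hS; rewrite mulrA.
Qed.
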